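(* If $(A_n)_{n=0}^\infty$ is an Appell sequence with constants $c_k$ defined by $\log f_A(t)=\sum_{k\ge1}c_k\frac{t^k}{k!}$ and $\lambda$ is a partition of $n \geq 1$, then \[ F_\lambda A_\lambda = x \sum_{\mu \lessdot \lambda} F_\mu A_\mu \ +\ \sum_{k=1}^{n} c_k\binom{n -1}{k-1} \sum_{\nu:\ \lambda/\nu \text{ is a rim hook of size } k} (-1)^{\operatorname{ht}(\lambda/\nu)} F_\nu A_\nu, \] where in the first sum $\mu$ ranges over partitions covered by $\lambda$ in Young's lattice (obtained by removing one cell).
   Context: An Appell sequence is a sequence of polynomials $(A_n)_{n\ge0}$ with $A_0=1$ and $A_n'=nA_{n-1}$ for $n\ge1$; it satisfies $\sum_k A_k(x)t^k/k!=e^{xt}f_A(t)$ with $f_A(0)=1$. For a partition $\lambda$ of length $r$, let $(n_1,\dots,n_r)=(\lambda_r,\lambda_{r-1}+1,\dots,\lambda_1+r-1)$ and $A_\lambda=\operatorname{Wr}[A_{n_1},\dots,A_{n_r}]/\Delta(n_1,\dots,n_r)$, where $\operatorname{Wr}$ is the Wronskian and $\Delta$ the Vandermonde determinant $\prod_{i<j}(x_j-x_i)$; $A_\emptyset=1$. $F_\lambda$ is the number of standard Young tableaux of shape $\lambda$. A rim hook of size $k$ is a skew diagram $\lambda/\nu$ with $|\lambda|-|\nu|=k$ that is connected and contains no $2\times2$ square; its height $\operatorname{ht}(\lambda/\nu)$ is one less than the number of rows it occupies. *)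

(* Defs.v *)
From HB Require Import structures.
From mathcomp Require Import all_boot all_order all_algebra.
Set Implicit Arguments. Unset Strict Implicit. Unset Printing Implicit Defensive.
Import Order.TTheory GRing.Theory Num.Theory.
Local Open Scope ring_scope.

Definition is_partition (s : seq nat) : bool :=
  sorted (fun a b : nat => (b <= a)%N) s && all (fun x => (0 < x)%N) s.

Definition subdiag (nu la : seq nat) : bool :=
  (size nu <= size la)%N && all (fun i => nth 0%N nu i <= nth 0%N la i)%N (iota 0 (size nu)).

(* Enumeration of all partitions nu ⊆ la (each exactly once):
   weakly decreasing functions 'I_r -> 'I_(c+1) bounded by la, zeros dropped. *)
Definition subparts (la : seq nat) : seq (seq nat) :=
  [seq [seq x <- [seq nat_of_ord (f i) | i <- enum 'I_(size la)] | (0 < x)%N]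
  | f : {ffun 'I_(size la) -> 'I_(head 0%N la).+1} <- enum {ffun 'I_(size la) -> 'I_(head 0%N la).+1}
  & [forall i, (f i <= nth 0%N la i)%N]
    && sorted (fun a b : nat => (b <= a)%N) [seq nat_of_ord (f i) | i <- enum 'I_(size la)]].

Definition skew_cell (la nu : seq nat) (i j : nat) : bool :=
  (nth 0%N nu i <= j)%N && (j < nth 0%N la i)%N.

(* Number of standard Young tableaux of shape la: fillings of the cells of la
   bijectively with 1..n (n = |la|), increasing along rows and down columns.
   Fillings are stored as functions on the bounding box 'I_r * 'I_c, with value 0
   outside the diagram. *)
Definition is_syt (la : seq nat)
  (t : {ffun 'I_(size la) * 'I_(head 0%N la) -> 'I_(sumn la).+1}) : bool :=
  [forall p : 'I_(size la) * 'I_(head 0%N la), ~~ skew_cell la [::] p.1 p.2 ==> (t p == ord0)]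
  && [forall p : 'I_(size la) * 'I_(head 0%N la), skew_cell la [::] p.1 p.2 ==> (0 < t p)%N]
  && [forall p : 'I_(size la) * 'I_(head 0%N la), forall q : 'I_(size la) * 'I_(head 0%N la), skew_cell la [::] p.1 p.2 ==> skew_cell la [::] q.1 q.2 ==>
        (t p == t q) ==> (p == q)]
  && [forall p : 'I_(size la) * 'I_(head 0%N la), forall q : 'I_(size la) * 'I_(head 0%N la), skew_cell la [::] p.1 p.2 ==> skew_cell la [::] q.1 q.2 ==>
        (((p.1 == q.1) && (p.2.+1 == q.2)) || ((p.2 == q.2) && (p.1.+1 == q.1))) ==>
        (t p < t q)%N].

Arguments is_syt : clear implicits.

Definition F (la : seq nat) : nat := #|[set t | is_syt la t]|.

Definition covers (la mu : seq nat) : bool :=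
  is_partition mu && subdiag mu la && ((sumn mu).+1 == sumn la)%N.

Definition skew_adj (la nu : seq nat) : rel ('I_(size la) * 'I_(head 0%N la)) :=
  fun p q => skew_cell la nu p.1 p.2 && skew_cell la nu q.1 q.2 &&
    ((((p.1 : nat) == q.1) && ((p.2.+1 == q.2) || (q.2.+1 == p.2)))
     || (((p.2 : nat) == q.2) && ((p.1.+1 == q.1) || (q.1.+1 == p.1))))%N.

Arguments skew_adj : clear implicits.

Definition skew_connected (la nu : seq nat) : bool :=
  [forall p : 'I_(size la) * 'I_(head 0%N la), forall q : 'I_(size la) * 'I_(head 0%N la),
     skew_cell la nu p.1 p.2 ==> skew_cell la nu q.1 q.2 ==> connect (skew_adj la nu) p q].

Definition skew_no2x2 (la nu : seq nat) : bool :=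
  [forall p : 'I_(size la) * 'I_(head 0%N la),
     ~~ [&& skew_cell la nu p.1 p.2, skew_cell la nu p.1.+1 p.2,
            skew_cell la nu p.1 p.2.+1 & skew_cell la nu p.1.+1 p.2.+1]].

Definition rim_hook (la nu : seq nat) (k : nat) : bool :=
  [&& is_partition nu, subdiag nu la, (sumn la - sumn nu == k)%N,
      skew_connected la nu & skew_no2x2 la nu].

Definition ht (la nu : seq nat) : nat :=
  (count (fun i => nth 0%N nu i < nth 0%N la i)%N (iota 0 (size la))).-1.

Section Appell.
Variable R : fieldType.

Definition appell (A : nat -> {poly R}) : Prop :=
  A 0%N = 1 /\ forall n : nat, (A n.+1)^`() = (n.+1)%:R *: A n.

(* c_k := k! [t^k] log f_A(t), with f_A(t) = sum_k A_k(0) t^k / k!, and the formal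
   logarithm log(1+u) = sum_{m>=1} (-1)^(m+1) u^m / m; only m <= k and terms of
   f_A of degree <= k contribute to the coefficient of t^k. *)
Definition fA_trunc (A : nat -> {poly R}) (k : nat) : {poly R} :=
  \sum_(1 <= j < k.+1) ((A j).[0] / (j`!)%:R) *: 'X^j.

Definition cA (A : nat -> {poly R}) (k : nat) : R :=
  (k`!)%:R * (\sum_(1 <= m < k.+1)
                 ((-1) ^+ m.+1 / m%:R) *: (fA_trunc A k) ^+ m)`_k.

(* (n_1,...,n_r) = (la_r, la_{r-1}+1, ..., la_1 + r - 1), 0-indexed *)
Definition nseqp (la : seq nat) (i : nat) : nat := (nth 0%N la (size la - 1 - i) + i)%N.

Definition Wr (A : nat -> {poly R}) (la : seq nat) : {poly R} :=
  \det (\matrix_(i < size la, j < size la) (A (nseqp la j))^`(i)).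

Definition Vdm (la : seq nat) : nat :=
  (\prod_(i < size la) \prod_(j < size la | (i < j)%N) (nseqp la j - nseqp la i))%N.

Definition AL (A : nat -> {poly R}) (la : seq nat) : {poly R} :=
  ((Vdm la)%:R)^-1 *: Wr A la.

End Appell.

(* Main.v *)
Require Import Defs.
From HB Require Import structures.
From mathcomp Require Import all_boot all_order all_algebra all_fingroup.
From mathcomp Require Import zify ring.
Set Implicit Arguments. Unset Strict Implicit. Unset Printing Implicit Defensive.
Import Order.TTheory GRing.Theory Num.Theory.
Local Open Scope ring_scope.

(** Put [a_m = A_m / m!], so that [sum_m a_m t^m = exp (x t + sum_k c_k t^k / k!)],
    and [S_la = det (a_(la_j - j + i))], the Schur function of [la] at
    [h_m = a_m]. Logarithmic differentiation gives [m a_m = sum_k p_k a_(m-k)] with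
    [p_1 = x + c_1] and [p_k = c_k / (k-1)!] for [k > 1].

    Multiplying each entry [a_m] of row [j] by [m], and summing the resulting
    determinants over [j], multiplies [S_la] by [n]; this gives
    [n S_la = sum_k p_k sum_j D_(j,k)], where [D_(j,k)] is the determinant in which
    the [j]-th beta number [la_j + r - 1 - j] is lowered by [k].
    It vanishes if the new number is negative or already present; otherwise sorting
    the beta numbers produces [(-1)^ht S_nu] for exactly one rim hook [la / nu] of
    size [k], and every rim hook arises once (Murnaghan-Nakayama).

    The case [a_m = 1 / m!] gives the recurrence [n S_la = sum_mu S_mu] over
    [mu] covered by [la]; removing the largest entry of a tableau gives the same
    recurrence for [F_la / n!], so [F_la = n! det (1 / (la_j - j + i)!)]. Hence
    [F_la A_la = n! S_la] and the theorem is the recurrence for [S_la]. *)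

(** * Partitions *)

Lemma geq_trans : transitive (fun a b : nat => (b <= a)%N).
Proof. by move=> a b c h1 h2; apply: leq_trans h2 h1. Qed.

Lemma partition_nonincreasing la i j :
  is_partition la -> (i <= j)%N -> (nth 0 la j <= nth 0 la i)%N.
Proof.
move=> /andP[sla _] lij; case: (ltnP j (size la)) => hj; last by rewrite nth_default.
apply: (sorted_leq_nth geq_trans leqnn 0%N sla) => //.
by rewrite inE; apply: leq_ltn_trans hj.
Qed.

Lemma partition_nth_gt0 la i : is_partition la -> (0 < nth 0 la i)%N = (i < size la)%N.
Proof.
move=> /andP[_ ala]; case: (ltnP i (size la)) => hi; last by rewrite nth_default.
exact: (allP ala _ (mem_nth 0%N hi)).
Qed.

(** Parts are positive, so the length is the first index at which the default value 0 appears. *)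
Lemma partition_ext a b : is_partition a -> is_partition b ->
  (forall i, nth 0%N a i = nth 0%N b i) -> a = b.
Proof.
move=> pa pb hab; apply: (@eq_from_nth _ 0%N) => [|i _]; last exact: hab.
have h i : (i < size a)%N = (i < size b)%N by rewrite -!partition_nth_gt0 // hab.
apply/eqP; rewrite eqn_leq; have := h (size a); have := h (size b).
by rewrite !ltnn; lia.
Qed.

Lemma partition_head la : is_partition la -> forall i, (nth 0 la i <= head 0 la)%N.
Proof. by move=> pla i; rewrite -nth0; apply: partition_nonincreasing. Qed.

Lemma subdiagP nu la : is_partition nu -> is_partition la ->
  reflect (forall i, nth 0 nu i <= nth 0 la i)%N (subdiag nu la).
Proof.
move=> pnu pla; apply: (iffP andP) => [[hs /allP h] i|h].
  case: (ltnP i (size nu)) => hi; last by rewrite nth_default.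
  by apply: h; rewrite mem_iota.
split; last by apply/allP => i _.
rewrite leqNgt; apply/negP => hlt.
by have := h (size la); rewrite [in X in (_ <= X)%N]nth_default // leqNgt partition_nth_gt0 // hlt.
Qed.

Lemma sumn_big la N : (size la <= N)%N -> sumn la = (\sum_(i < N) nth 0 la i)%N.
Proof.
move=> h; rewrite sumnE (big_nth 0%N) -(big_mkord xpredT (nth 0%N la)).
rewrite (@big_cat_nat _ _ _ (size la) 0 N) //= [X in (_ + X)%N]big1_seq ?addn0 //.
by move=> i; rewrite mem_index_iota => /andP[_ /andP[hi _]]; rewrite nth_default.
Qed.

(** Lowering rows can leave trailing zeros; dropping them restores a genuine partition. *)
Definition shape_of (r : nat) (l : nat -> nat) : seq nat :=
  [seq x <- mkseq l r | (0 < x)%N].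

(** In a weakly decreasing sequence the zeros form a tail, where [nth] returns the default 0
    anyway. *)
Lemma filter_gt0_sorted (s : seq nat) i : sorted (fun a b : nat => (b <= a)%N) s ->
  nth 0%N [seq x <- s | (0 < x)%N] i = nth 0%N s i.
Proof.
elim: s i => [|x s IH] i //= hs.
case: (posnP x) => [x0|xp]; last first.
  by case: i => [|i] //=; apply: IH; apply: path_sorted hs.
have z : all (fun y => y == 0%N) s.
  apply/allP => y ys; have := order_path_min geq_trans hs => /allP /(_ y ys).
  by rewrite x0 leqn0.
have -> : [seq y <- s | (0 < y)%N] = [::].
  by rewrite (eq_in_filter (a2 := pred0)) ?filter_pred0 // => y /(allP z) /eqP ->.
rewrite nth_nil; case: i => [|i] //=.
case: (ltnP i (size s)) => hi; last by rewrite nth_default.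
by have /eqP := allP z _ (mem_nth 0%N hi).
Qed.

Lemma mkseq_sorted (r : nat) (l : nat -> nat) :
  (forall i, i.+1 < r -> l i.+1 <= l i)%N ->
  sorted (fun a b : nat => (b <= a)%N) (mkseq l r).
Proof.
move=> h; case: r h => [|r] h //; apply/(sortedP 0%N) => i.
by rewrite size_mkseq => hi; rewrite !nth_mkseq ?h //; apply: ltnW.
Qed.

Lemma nth_shape_of r l i : (forall i, i.+1 < r -> l i.+1 <= l i)%N ->
  nth 0%N (shape_of r l) i = if (i < r)%N then l i else 0%N.
Proof.
move=> h; rewrite filter_gt0_sorted ?mkseq_sorted //.
by case: ltnP => hi; [rewrite nth_mkseq | rewrite nth_default ?size_mkseq].
Qed.

Lemma is_partition_filter_gt0 (s : seq nat) : sorted (fun a b : nat => (b <= a)%N) s ->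
  is_partition [seq x <- s | (0 < x)%N].
Proof.
move=> hs; apply/andP; split; first by apply: sorted_filter hs; apply: geq_trans.
by rewrite filter_all.
Qed.

Lemma is_partition_shape_of r l : (forall i, i.+1 < r -> l i.+1 <= l i)%N ->
  is_partition (shape_of r l).
Proof. by move=> h; apply/is_partition_filter_gt0/mkseq_sorted. Qed.

(** * Enumeration of the partitions contained in [la] *)

Section Subparts.
Variable la : seq nat.
Hypothesis pla : is_partition la.
Let r := size la.
Let c := head 0%N la.

Let nth_row (f : {ffun 'I_r -> 'I_c.+1}) (i : 'I_r) :
  nth 0%N [seq nat_of_ord (f i) | i <- enum 'I_r] i = f i.
Proof. by rewrite (nth_map i) ?size_enum_ord // nth_ord_enum. Qed.

Lemma mem_subparts nu : (nu \in subparts la) = is_partition nu && subdiag nu la.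
Proof.
apply/mapP/andP => [[f] | [pnu snu]].
  rewrite mem_filter => /andP[/andP[/forallP hf hs] _] ->.
  have pn := is_partition_filter_gt0 hs.
  split=> //; apply/subdiagP => // i; rewrite filter_gt0_sorted //.
  case: (ltnP i r) => hi; last first.
    by rewrite [X in (X <= _)%N]nth_default // size_map size_enum_ord.
  by have := nth_row f (Ordinal hi); rewrite /= => ->; apply: (hf (Ordinal hi)).
have hle := elimT (subdiagP pnu pla) snu.
pose f : {ffun 'I_r -> 'I_c.+1} := [ffun i : 'I_r => inord (nth 0%N nu i)].
have fE i : f i = nth 0%N nu i :> nat.
  rewrite ffunE inordK // ltnS; apply: leq_trans (hle i) _; exact: partition_head.
have sE : [seq nat_of_ord (f i) | i <- enum 'I_r] = mkseq (nth 0%N nu) r.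
  by rewrite (eq_map fE) (map_comp (nth 0%N nu) val) val_enum_ord.
have hs : sorted (fun a b : nat => (b <= a)%N) (mkseq (nth 0%N nu) r).
  by apply: mkseq_sorted => i _; apply: partition_nonincreasing.
exists f.
  rewrite mem_filter mem_enum andbT sE; apply/andP; split=> //.
  by apply/forallP => i; rewrite fE.
rewrite sE; apply: partition_ext => //; first exact: is_partition_filter_gt0.
move=> i; rewrite filter_gt0_sorted //.
case: (ltnP i r) => hi; first by rewrite nth_mkseq.
rewrite [RHS]nth_default ?size_mkseq // nth_default //.
by apply: leq_trans hi; case/andP: snu.
Qed.

Lemma uniq_subparts : uniq (subparts la).
Proof.
rewrite map_inj_in_uniq; first by apply: filter_uniq; apply: enum_uniq.
move=> f g.
rewrite !mem_filter => /andP[/andP[_ hf] _] /andP[/andP[_ hg] _] efg.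
apply/ffunP => i; apply: val_inj => /=; rewrite -!nth_row.
by rewrite -(filter_gt0_sorted _ hf) -(filter_gt0_sorted _ hg) efg.
Qed.
End Subparts.

(** * Rim hooks *)

(* A rim hook of size [k] occupying the rows [j .. m]; the last clause records the
   size through the beta numbers: [nu_m - m = la_j - j - k]. *)
Definition hook_rows (la nu : seq nat) (k j m : nat) : Prop :=
  [/\ (j <= m)%N, (forall i, (i < j)%N || (m < i)%N -> nth 0%N nu i = nth 0%N la i),
      (forall i, (j <= i < m)%N -> (nth 0%N nu i).+1 = nth 0%N la i.+1),
      (nth 0 nu m < nth 0 la m)%N
    & (nth 0 nu m + k + j = nth 0 la j + m)%N].

Section Hook.
Variables (la nu : seq nat).
Hypotheses (pla : is_partition la) (pnu : is_partition nu).
Let lam i := nth 0%N la i.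
Let nuu i := nth 0%N nu i.

Let lamS i : (lam i.+1 <= lam i)%N. Proof. exact: partition_nonincreasing. Qed.
Let nuuS i : (nuu i.+1 <= nuu i)%N. Proof. exact: partition_nonincreasing. Qed.
Let lam_le i j : (i <= j)%N -> (lam j <= lam i)%N. Proof. exact: partition_nonincreasing. Qed.

Lemma hook_rows_lt k j m : hook_rows la nu k j m ->
  forall i, (j <= i <= m)%N -> (nth 0 nu i < nth 0 la i)%N.
Proof.
move=> [jm _ h2 h3 _] i /andP[ji im].
case: (ltngtP i m) => [lt|//|->] //; last by lia.
by have := h2 i; have := lamS i; rewrite /lam; lia.
Qed.

Lemma hook_rows_size k j m : hook_rows la nu k j m -> (m < size la)%N.
Proof. by move=> [_ _ _ h _]; rewrite -partition_nth_gt0 //; lia. Qed.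

Lemma hook_rows_subdiag k j m : hook_rows la nu k j m -> subdiag nu la.
Proof.
move=> h; apply/subdiagP => // i.
case: (boolP ((i < j)%N || (m < i)%N)) => hi; first by case: h => _ e _ _ _; rewrite e.
by apply/ltnW/(hook_rows_lt h); lia.
Qed.

Let ps (l : nat -> nat) N := (\sum_(i < N) l i)%N.
Let psS l N : ps l N.+1 = (ps l N + l N)%N. Proof. by rewrite /ps big_ord_recr. Qed.

Lemma hook_rows_sumn k j m : hook_rows la nu k j m -> sumn la = (sumn nu + k)%N.
Proof.
move=> h; have [jm h1 h2 h3 h4] := h.
have mla := hook_rows_size h; have /andP[snu _] := hook_rows_subdiag h.
rewrite (sumn_big (leqnn (size la))) (sumn_big snu) -/(ps lam _) -/(ps nuu _).
have e1 N : (N <= j)%N -> ps lam N = ps nuu N.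
  elim: N => [|N IH] hN; first by rewrite /ps !big_ord0.
  by rewrite !psS IH ?[nuu N]h1 // ?hN //; lia.
(* Inside the hook [nu_i + 1 = la_(i+1)], so the difference of the partial sums telescopes. *)
have e2 N : (j + N <= m)%N -> (ps lam (j + N) + lam (j + N) = ps nuu (j + N) + lam j + N)%N.
  elim: N => [|N IH] hN; first by rewrite !addn0 e1.
  rewrite addnS !psS; have := IH (ltac:(lia)).
  by have := h2 (j + N)%N (ltac:(lia)); rewrite -/(nuu _) -/(lam _); lia.
have e3 : ps lam m.+1 = (ps nuu m.+1 + k)%N.
  rewrite !psS; have := e2 (m - j)%N (ltac:(lia)); rewrite subnKC //.
  by move: h4; rewrite -/(nuu m) -/(lam j); lia.
have e4 N : ps lam (m.+1 + N) = (ps nuu (m.+1 + N) + k)%N.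
  elim: N => [|N IH]; first by rewrite addn0.
  rewrite addnS (psS lam (m.+1 + N)) (psS nuu (m.+1 + N)) IH; have := h1 (m.+1 + N)%N (ltac:(lia)).
  by rewrite -/(nuu _) -/(lam _) => ->; lia.
by have := e4 (size la - m.+1)%N; rewrite subnKC.
Qed.

Lemma hook_rows_ht k j m : hook_rows la nu k j m -> ht la nu = (m - j)%N.
Proof.
move=> h; have [jm h1 h2 h3 h4] := h; have mla := hook_rows_size h.
rewrite /ht (eq_count (a2 := fun i => (j <= i <= m)%N)); last first.
  move=> i; apply/idP/idP => [hi|]; last exact: hook_rows_lt h i.
  rewrite -[_ && _]negbK; apply/negP => hn.
  have e : nth 0%N nu i = nth 0%N la i by apply: h1; lia.
  by rewrite e ltnn in hi.
suff -> : count (fun i => (j <= i <= m)%N) (iota 0 (size la)) = (m.+1 - j)%N by lia.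
have -> : size la = (j + ((m.+1 - j) + (size la - m.+1)))%N by lia.
rewrite !iotaD !count_cat add0n.
rewrite (eq_in_count (a2 := pred0)) ?count_pred0; last first.
  by move=> i; rewrite mem_iota /=; lia.
rewrite (eq_in_count (a2 := predT)) ?count_predT ?size_iota; last first.
  by move=> i; rewrite mem_iota /=; lia.
rewrite (eq_in_count (a2 := pred0)) ?count_pred0; last first.
  by move=> i; rewrite mem_iota /=; lia.
by rewrite add0n addn0.
Qed.

Let cell := ('I_(size la) * 'I_(head 0%N la))%type.

(** A square needs two columns common to consecutive rows, but rows [i] and [i+1] of the hook share
    only column [nu_i], since [nu_i + 1 = la_(i+1)]. *)
Lemma hook_rows_no2x2 k j m : hook_rows la nu k j m -> skew_no2x2 la nu.
Proof.
move=> h; have [jm h1 h2 h3 h4] := h.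
apply/forallP => [[x y]] /=; rewrite /skew_cell; apply/negP => /and4P[/andP[a b] _ _ /andP[c d]].
case: (boolP ((x < j)%N || (m < x)%N)) => hx.
  by have := h1 x hx; lia.
case: (ltngtP x m) => hm; first by have := h2 x (ltac:(lia)); lia.
  by lia.
by rewrite hm in a b c d; have := h1 m.+1; have := nuuS m; rewrite /nuu; lia.
Qed.

Lemma skew_adj_sym : symmetric (skew_adj la nu).
Proof. by move=> p q; rewrite /skew_adj; lia. Qed.

(** Every cell is joined to the leftmost cell [e] of the bottom row [m]: walk left to column [nu_x],
    step down to [(x+1, nu_x)], which is the last cell of its row, and repeat. *)
Lemma hook_rows_connected k j m : hook_rows la nu k j m -> skew_connected la nu.
Proof.
move=> h; have [jm h1 h2 h3 h4] := h; have mla := hook_rows_size h.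
have csym := fingraph.sym_connect_sym skew_adj_sym.
have lc i : (lam i <= head 0 la)%N by apply: partition_head.
have hcell (x : 'I_(size la)) (y : 'I_(head 0%N la)) : skew_cell la nu x y -> (j <= x <= m)%N.
  move=> hxy; rewrite -[_ && _]negbK; apply/negP => hn.
  by have := h1 x (ltac:(lia)); move: hxy; rewrite /skew_cell; lia.
have along d : forall (x : 'I_(size la)) (y z : 'I_(head 0%N la)),
    skew_cell la nu x y -> skew_cell la nu x z -> (z = y + d :> nat)%N ->
    connect (skew_adj la nu) (x, y) (x, z).
  elim: d => [|d IH] x y z cy cz e.
    by have -> : z = y by apply: val_inj; rewrite /= e addn0.
  have hz : (y + d < head 0%N la)%N by have := ltn_ord z; lia.
  have cz' : skew_cell la nu x (Ordinal hz) by move: cy cz; rewrite /skew_cell /=; lia.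
  apply: connect_trans (IH x y (Ordinal hz) cy cz' erefl) (connect1 _).
  by rewrite /skew_adj cz' cz /=; lia.
have hnm : (nuu m < head 0%N la)%N by have := lc m; rewrite /lam /nuu; lia.
pose e : cell := (Ordinal mla, Ordinal hnm).
suff toe d : forall (x : 'I_(size la)) (y : 'I_(head 0%N la)), (x + d = m)%N ->
    skew_cell la nu x y -> connect (skew_adj la nu) (x, y) e.
  apply/forallP => -[x y]; apply/forallP => -[x' y']; apply/implyP => cp; apply/implyP => cq.
  have e1 := toe (m - x)%N x y _ cp; have e2 := toe (m - x')%N x' y' _ cq.
  have := hcell _ _ cp; have := hcell _ _ cq => /= b1 b2.
  apply: connect_trans (e1 (ltac:(lia))) _; rewrite csym; exact: (e2 (ltac:(lia))).
elim: d => [|d IH] x y.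
  rewrite addn0 => xm cxy; rewrite csym.
  have ex : x = Ordinal mla by apply: val_inj.
  rewrite /e -ex; apply: (along (y - nuu m)%N) => //.
    by rewrite /skew_cell /= xm; have := h3; rewrite /nuu; lia.
  by move: cxy; rewrite /skew_cell /= xm /nuu; lia.
move=> xd cxy.
have := hcell _ _ cxy; rewrite /= => bx.
have hx1 : (x.+1 < size la)%N by lia.
have e2 := h2 x (ltac:(lia)).
have lt1 := hook_rows_lt h (i := x) (ltac:(lia)); have lt2 := hook_rows_lt h (i := x.+1) (ltac:(lia)).
have hz : (nuu x < head 0%N la)%N by have := lc x; rewrite /nuu /lam; lia.
have c1 : skew_cell la nu x (Ordinal hz) by rewrite /skew_cell /= /nuu; lia.
have c2 : skew_cell la nu (Ordinal hx1) (Ordinal hz).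
  by rewrite /skew_cell /= /nuu; lia.
apply: (@connect_trans _ _ (x, Ordinal hz)).
  rewrite csym; apply: (along (y - nuu x)%N) => //.
  by move: cxy; rewrite /skew_cell /= /nuu; lia.
apply: (@connect_trans _ _ (Ordinal hx1, Ordinal hz)).
  by apply: connect1; rewrite /skew_adj c1 c2 /=; lia.
by apply: IH => //=; lia.
Qed.

Lemma hook_rows_rim_hook k j m : hook_rows la nu k j m -> rim_hook la nu k.
Proof.
move=> h; rewrite /rim_hook pnu (hook_rows_subdiag h) (hook_rows_sumn h) addKn eqxx /=.
by rewrite (hook_rows_connected h) (hook_rows_no2x2 h).
Qed.

(* If no cell of row [i] lies above a cell of row [i.+1], the cells in rows [<= i]
   are closed under adjacency. *)
Lemma skew_connected_overlap i a b : subdiag nu la -> skew_connected la nu ->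
  (a <= i < b)%N -> (nth 0 nu a < nth 0 la a)%N -> (nth 0 nu b < nth 0 la b)%N ->
  [/\ (nth 0 nu i < nth 0 la i)%N, (nth 0 nu i.+1 < nth 0 la i.+1)%N
    & (nth 0 nu i < nth 0 la i.+1)%N].
Proof.
move=> sub con /andP[ai ib] ha hb.
have sz x : (nth 0 nu x < nth 0 la x)%N -> (x < size la)%N.
  by move=> hx; rewrite -partition_nth_gt0 //; lia.
have hd x : (nth 0 nu x < nth 0 la x)%N -> (nth 0 nu x < head 0 la)%N.
  by move=> hx; apply: leq_trans hx _; apply: partition_head.
pose p : cell := (Ordinal (sz _ ha), Ordinal (hd _ ha)).
pose q : cell := (Ordinal (sz _ hb), Ordinal (hd _ hb)).
have /implyP := forallP (forallP con p) q.
have cp : skew_cell la nu p.1 p.2 by rewrite /skew_cell /= leqnn.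
have cq : skew_cell la nu q.1 q.2 by rewrite /skew_cell /= leqnn.
move=> /(_ cp) /implyP /(_ cq) cpq.
case: (boolP [exists u : cell, exists v : cell,
         [&& skew_adj la nu u v, u.1 <= i & i < v.1]%N]) => [|hno].
  move=> /existsP[[u1 u2]] /existsP[[v1 v2]] /and3P[].
  rewrite /skew_adj /skew_cell /= => adj hu hv.
  have [eu ev] : (u1 = i :> nat)%N /\ (v1 = i.+1 :> nat)%N by lia.
  by move: adj; rewrite eu ev => adj; split; lia.
have cl : closed (skew_adj la nu) [pred u : cell | (u.1 <= i)%N].
  apply: intro_closed; first exact: (fingraph.sym_connect_sym skew_adj_sym).
  move=> u v uv; rewrite !inE => hu; rewrite leqNgt; apply/negP => hv.
  by case/negP: hno; apply/existsP; exists u; apply/existsP; exists v; rewrite uv hu hv.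
have := closed_connect cl cpq; rewrite !inE /= ai; lia.
Qed.

(** The rows [j] and [m] are the first and the last one in which [nu] and [la] differ. *)
Lemma rim_hook_rows k : (0 < k)%N -> rim_hook la nu k -> exists j m, hook_rows la nu k j m.
Proof.
move=> k0 /and5P[_ sub /eqP sk con no2].
have le := elimT (subdiagP pnu pla) sub.
have sz x : (nth 0 nu x < nth 0 la x)%N -> (x < size la)%N.
  by move=> hx; rewrite -partition_nth_gt0 //; lia.
have ex : exists i, (nth 0 nu i < nth 0 la i)%N.
  have [/existsP[i hi]|/existsPn hn] :=
    boolP [exists i : 'I_(size la), (nth 0 nu i < nth 0 la i)%N]; first by exists i.
  suff e : sumn la = sumn nu by lia.
  have /andP[snu _] := sub; rewrite (sumn_big (leqnn _)) (sumn_big snu).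
  by apply: eq_bigr => i _; have := hn i; have := le i; lia.
pose j := ex_minn ex.
have bnd i : (nth 0 nu i < nth 0 la i)%N -> (i <= size la)%N by move/sz/ltnW.
pose m := ex_maxn ex bnd.
have [hj minj] : (nth 0 nu j < nth 0 la j)%N /\ (forall i, (nth 0 nu i < nth 0 la i)%N -> (j <= i)%N).
  by rewrite /j; case: ex_minnP.
have [hm maxm] : (nth 0 nu m < nth 0 la m)%N /\ (forall i, (nth 0 nu i < nth 0 la i)%N -> (i <= m)%N).
  by rewrite /m; case: ex_maxnP.
clearbody j m.
have jm := minj _ hm.
have h1 i : (i < j)%N || (m < i)%N -> nth 0%N nu i = nth 0%N la i.
  by have := minj i; have := maxm i; have := le i; lia.
(* Connectedness gives rows [i] and [i+1] a common column; a second one would produce a 2x2 square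
   at [(i, nu_i)]. *)
have h2 i : (j <= i < m)%N -> (nth 0%N nu i).+1 = nth 0%N la i.+1.
  move=> hi; have [o1 o2 o3] := skew_connected_overlap sub con hi hj hm.
  apply/eqP; rewrite eqn_leq o3 /= leqNgt; apply/negP => hlt.
  have hx := sz _ o1.
  have hy : (nth 0 nu i < head 0 la)%N by apply: leq_trans o1 _; apply: partition_head.
  have := forallP no2 (Ordinal hx, Ordinal hy); rewrite /= /skew_cell.
  by have := lamS i; have := nuuS i; rewrite /lam /nuu; lia.
have h0 : (nth 0 nu m <= nth 0 la j + m - j)%N by have := lam_le jm; rewrite /lam; lia.
(* The size as measured by the beta numbers; counting cells identifies it with [k]. *)
pose k' := (nth 0 la j + m - j - nth 0 nu m)%N.
have h : hook_rows la nu k' j m by split => //; rewrite /k'; lia.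
exists j, m; suff <- : k' = k by [].
by have := hook_rows_sumn h; lia.
Qed.

End Hook.

(** The size clause fixes [nu_m - m], hence [nu'_m' - m' = nu_m - m]. If [m < m'], this contradicts
    [nu'_m' < la_m' <= la_(m+1) = nu_(m+1) <= nu_m]. Once [m = m'], every row is determined. *)
Lemma hook_rows_unique la nu nu' k j m m' : is_partition la ->
  is_partition nu -> is_partition nu' ->
  hook_rows la nu k j m -> hook_rows la nu' k j m' -> nu = nu'.
Proof.
move=> pla; wlog mm : nu nu' m m' / (m <= m')%N.
  move=> H p p' h h'; case/orP: (leq_total m m') => hm; first exact: H h h'.
  by apply/esym; apply: H h' h.
move=> p p' h h'.
have em : m = m'.
  apply/eqP; rewrite eqn_leq mm leqNgt; apply/negP => lt.
  case: h h' => [jm h1 h2 h3 h4] [jm' h1' h2' h3' h4'].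
  have := h1 m.+1; rewrite ltnS leqnn orbT => /(_ isT) e.
  have := partition_nonincreasing p (leqnSn m); have := partition_nonincreasing pla lt.
  by lia.
subst m'.
case: h h' => [jm h1 h2 h3 h4] [jm' h1' h2' h3' h4'].
apply: partition_ext => // i.
case: (boolP ((i < j)%N || (m < i)%N)) => hi; first by rewrite h1 ?h1'.
case: (ltngtP i m) => im; last by rewrite im; lia.
  by have := h2 i (ltac:(lia)); have := h2' i (ltac:(lia)); lia.
by lia.
Qed.

(** Sort the lowered beta number back into place: the rows it passes move up by one, which turns
    [la_(i+1)] into [la_(i+1) - 1] in row [i]. The last hypothesis excludes a collision. *)
Lemma hook_rows_exists la k j : is_partition la -> (0 < k)%N -> (j < size la)%N ->
  (k <= nth 0 la j + (size la - 1 - j))%N ->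
  (forall i, (i < size la)%N -> i <> j ->
     (nth 0 la i + (size la - 1 - i) + k <> nth 0 la j + (size la - 1 - j))%N) ->
  exists nu m, is_partition nu /\ hook_rows la nu k j m.
Proof.
move=> pla k0 jr kb hne; set r := size la in jr kb hne *.
have lamS i : (nth 0 la i.+1 <= nth 0 la i)%N by apply: partition_nonincreasing.
(* The last [m] satisfying [P] is the last row whose beta number exceeds the lowered one; [j]
   qualifies because [k > 0]. *)
pose P m := [&& (j <= m)%N, (m < r)%N & (nth 0 la j + (r - 1 - j) < nth 0 la m + (r - 1 - m) + k)%N].
have exP : exists m, P m by exists j; rewrite /P; lia.
have bP m : P m -> (m <= r)%N by case/and3P => _ /ltnW.
pose m := ex_maxn exP bP.
have [/and3P[jm mr hm] maxm] : P m /\ forall i, P i -> (i <= m)%N by rewrite /m; case: ex_maxnP.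
clearbody m.
have hm1 : (m.+1 < r)%N -> (nth 0 la m.+1 + k + j <= nth 0 la j + m)%N.
  move=> lt; have := maxm m.+1; rewrite ltnn /P lt (leqW jm) /=.
  by have := hne m.+1 lt (ltac:(lia)); lia.
(* This makes the truncated subtraction in row [m] of [l] exact. For the last row it is the bound
   [kb]; otherwise it comes from comparison with row [m+1]. *)
have hk : (k + j <= nth 0 la j + m)%N.
  by case: (ltnP m.+1 r) => [/hm1|]; lia.
pose l i := if (i < j)%N || (m < i)%N then nth 0%N la i
            else if (i < m)%N then (nth 0%N la i.+1).-1 else (nth 0 la j + m - k - j)%N.
have lapos i : (i < r)%N -> (0 < nth 0 la i)%N by rewrite partition_nth_gt0.
have lS i : (i.+1 < r)%N -> (l i.+1 <= l i)%N.
  move=> ir; rewrite /l; have a1 := lamS i; have a2 := lamS i.+1; have a3 := lapos _ ir.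
  have e1 : i.+1 = m -> nth 0%N la i.+1 = nth 0%N la m by move=> ->.
  have e2 : i = m -> nth 0%N la i.+1 = nth 0%N la m.+1 by move=> ->.
  have e3 : i.+1 = j -> nth 0%N la i.+1 = nth 0%N la j by move=> ->.
  by do !case: ifP; lia.
have nE i : nth 0%N (shape_of r l) i = if (i < r)%N then l i else 0%N by apply: nth_shape_of.
exists (shape_of r l), m; split; first exact: is_partition_shape_of.
split=> //.
- move=> i hi; rewrite nE /l hi; case: ltnP => // ir; by rewrite nth_default.
- move=> i hi; rewrite nE /l.
  have -> : (i < r)%N by lia.
  have -> : (i < j)%N || (m < i)%N = false by lia.
  have -> : (i < m)%N by lia.
  by have := lapos i.+1; lia.
- rewrite nE /l mr ltnn.
  have -> : (m < j)%N || false = false by lia.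
  by lia.
- rewrite nE /l mr ltnn.
  have -> : (m < j)%N || false = false by lia.
  by lia.
Qed.

(** * Determinants in beta numbers *)

Lemma sumn_partition_gt0 la : is_partition la -> (0 < sumn la)%N = (0 < size la)%N.
Proof. by case: la => [|x s] //= /andP[_ /= /andP[x0 _]]; rewrite addn_gt0 x0. Qed.

(** Row by row [mu] is at most [la], and the totals differ by 1, so one row loses one cell. *)
Lemma covers_hook_rows la mu : is_partition la -> covers la mu ->
  exists m, hook_rows la mu 1 m m.
Proof.
move=> pla /andP[/andP[pmu sub] /eqP sz].
have le := elimT (subdiagP pmu pla) sub; have /andP[smu _] := sub.
move: sz; rewrite (sumn_big (leqnn (size la))) (sumn_big smu) => sz.
have [/existsP[m hm]|/existsPn hn] :=
    boolP [exists i : 'I_(size la), (nth 0 mu i < nth 0 la i)%N]; last first.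
  suff e : (\sum_(i < size la) nth 0 mu i = \sum_(i < size la) nth 0 la i)%N by lia.
  by apply: eq_bigr => i _; have := hn i; have := le i; lia.
exists m; move: sz; rewrite (bigD1 m) //= [RHS](bigD1 m) //= => sz.
have h1 i : (i != m :> nat) -> nth 0%N mu i = nth 0%N la i.
  move=> im; case: (ltnP i (size la)) => hi; last first.
    by rewrite !nth_default //; apply: leq_trans hi.
  apply/eqP; rewrite eqn_leq le /= leqNgt; apply/negP => lt.
  have hi' : Ordinal hi != m by rewrite -val_eqE.
  move: sz; rewrite (bigD1 (Ordinal hi)) //= [X in (_ = _ + X)%N](bigD1 (Ordinal hi)) //=.
  set S1 := (X in ((_ + (_ + X)%N)%N).+1); set S2 := (X in (_ = _ + (_ + X))%N).
  have : (S1 <= S2)%N by apply: leq_sum => x _.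
  by lia.
split=> //.
- by move=> i hi; apply: h1; lia.
- by move=> i; lia.
- move: sz; rewrite (eq_bigr (fun i : 'I_(size la) => nth 0%N la i)) => [|i im]; first by lia.
  by apply: h1.
Qed.

Lemma rim_hook1 la mu : is_partition la -> rim_hook la mu 1 = covers la mu.
Proof.
move=> pla; apply/idP/idP => [h|h].
  have /and5P[pmu sub _ _ _] := h.
  have [j [m hk]] := rim_hook_rows pla pmu (ltn0Sn 0) h.
  by rewrite /covers pmu sub (hook_rows_sumn pla pmu hk) addn1 /=.
have /andP[/andP[pmu sub] _] := h.
by have [m hk] := covers_hook_rows pla h; apply: hook_rows_rim_hook hk.
Qed.

Lemma ht_covers la mu : is_partition la -> covers la mu -> ht la mu = 0%N.
Proof.
move=> pla h; have /andP[/andP[pmu sub] _] := h.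
by have [m hk] := covers_hook_rows pla h; rewrite (hook_rows_ht pla pmu hk) subnn.
Qed.

Definition beta (r : nat) (l : nat -> nat) (j : nat) : nat := (l j + (r - 1 - j))%N.

Definition update (b : nat -> nat) (j v x : nat) : nat := if x == j then v else b x.

Section BetaDet.
Variables (R : comNzRingType) (a : nat -> R).

(** The guard implements the convention that [a] vanishes at negative indices. *)
Definition hshift (p q : nat) : R := if (q <= p)%N then a (p - q)%N else 0.

(** Row [j] depends on [b j] alone, so lowering one number alters one row. For the beta numbers of
    [la] the entry is [a_(la_j - j + i)]. *)
Definition beta_det (r : nat) (b : nat -> nat) : R :=
  \det (\matrix_(j < r, i < r) hshift (b j) (r - 1 - i)).

Definition jacobi_trudi (r : nat) (la : seq nat) : R := beta_det r (beta r (nth 0%N la)).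

Lemma beta_det_repeat r b x y : (x < r)%N -> (y < r)%N -> x <> y -> b x = b y -> beta_det r b = 0.
Proof.
move=> hx hy xy bxy; apply: (@determinant_alternate _ _ _ (Ordinal hx) (Ordinal hy)).
  by rewrite -val_eqE; apply/eqP.
by move=> i; rewrite !mxE /= bxy.
Qed.

(** In the Leibniz sum the factor of row [j] is isolated, because the recurrence for [a] acts on it
    alone. *)
Lemma beta_det_update r b (j : 'I_r) v :
  beta_det r (update b j v) =
  \sum_(s : 'S_r) (-1) ^+ s * (hshift v (r - 1 - s j) *
     \prod_(x < r | x != j) hshift (b x) (r - 1 - s x)).
Proof.
apply: eq_bigr => s _; congr (_ * _); rewrite (bigD1 j) //= !mxE /update eqxx.
congr (_ * _); apply: eq_bigr => x xj; rewrite !mxE.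
by have -> : (x == j :> nat) = false by apply/negbTE.
Qed.

Section Recurrence.
Variable p : nat -> R.
Hypothesis rec : forall m, m%:R * a m = \sum_(1 <= k < m.+1) p k * a (m - k)%N.

(** This is the recurrence for [a] at index [b - q]; the terms with [k > b - q] vanish, which allows
    one bound [K] for all entries. If [q > b], both sides are 0. *)
Lemma hshift_rec b q K : (b < K)%N ->
  \sum_(1 <= k < K) p k * (if (k <= b)%N then hshift (b - k) q else 0) =
  (b%:R - q%:R) * hshift b q.
Proof.
move=> bK; rewrite /hshift; case: (leqP q b) => qb; last first.
  rewrite mulr0 big1 // => k _; case: ifP => _; rewrite ?mulr0 //.
  have -> : (q <= b - k)%N = false by lia.
  by rewrite mulr0.
rewrite -natrB // rec [RHS](@big_nat_widen _ _ _ _ _ K); last by lia.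
rewrite [RHS]big_mkcond /=. apply: eq_bigr => k _.
case: (ltnP k (b - q).+1) => hk.
  have -> : (k <= b)%N by lia.
  have -> : (q <= b - k)%N by lia.
  by congr (_ * a _); lia.
case: ifP => h; rewrite ?mulr0 //.
have -> : (q <= b - k)%N = false by lia.
by rewrite mulr0.
Qed.

(** In the Leibniz term of [s], row [j] contributes the factor [b_j - (r - 1 - s j)]. Summed over
    [j] this does not depend on [s], since [s] permutes the columns. *)
Lemma beta_det_rec r b K : (forall j, (j < r)%N -> (b j < K)%N) ->
  \sum_(1 <= k < K) p k *
     \sum_(j < r | (k <= b j)%N) beta_det r (update b j (b j - k)) =
  ((\sum_(j < r) b j)%N%:R - (\sum_(j < r) (r - 1 - j))%N%:R) * beta_det r b.
Proof.
move=> bK.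
transitivity (\sum_(j < r) \sum_(s : 'S_r) ((b j)%:R - (r - 1 - s j)%N%:R) *
    ((-1) ^+ s * \prod_(x < r) hshift (b x) (r - 1 - s x))).
  transitivity (\sum_(1 <= k < K) \sum_(j < r) p k *
      (if (k <= b j)%N then beta_det r (update b j (b j - k)) else 0)).
    by apply: eq_bigr => k _; rewrite big_mkcond mulr_sumr.
  rewrite exchange_big; apply: eq_bigr => j _.
  transitivity (\sum_(1 <= k < K) \sum_(s : 'S_r) 
     (p k * (if (k <= b j)%N then hshift (b j - k) (r - 1 - s j) else 0)) *
     ((-1) ^+ s * \prod_(x < r | x != j) hshift (b x) (r - 1 - s x))).
    apply: eq_bigr => k _; case: ifP => _; last first.
      by rewrite mulr0 big1 // => s _; rewrite mul0r.
    rewrite beta_det_update mulr_sumr; apply: eq_bigr => s _.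
    by rewrite !mulrA; congr (_ * _); rewrite -!mulrA; congr (_ * _); rewrite mulrC.
  rewrite exchange_big; apply: eq_bigr => s _.
  rewrite -mulr_suml hshift_rec ?bK // [X in _ = _ * (_ * X)](bigD1 j) //=.
  by rewrite !mulrA; congr (_ * _); rewrite -!mulrA; congr (_ * _); rewrite mulrC.
rewrite exchange_big /beta_det /determinant mulr_sumr; apply: eq_bigr => s _.
rewrite -mulr_suml; congr (_ * _); last first.
  by congr (_ * _); apply: eq_bigr => x _; rewrite mxE.
rewrite sumrB !natr_sum; congr (_ - _).
by rewrite [RHS](reindex_inj (@perm_inj _ s)).
Qed.

End Recurrence.

Hypothesis a0 : a 0%N = 1.

(** The row of an empty part is [(0, ..., 0, 1)]; expand along it. *)
Lemma jacobi_trudiS r la : nth 0%N la r = 0%N -> jacobi_trudi r.+1 la = jacobi_trudi r la.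
Proof.
move=> z; rewrite /jacobi_trudi /beta_det (expand_det_row _ ord_max) (bigD1 ord_max) //=.
rewrite big1 ?addr0 => [|i hi]; last first.
  rewrite mxE /beta /= z /hshift.
  have hi' : (i < r)%N by move: hi; rewrite -val_eqE /=; have := ltn_ord i; lia.
  have -> : (r.+1 - 1 - i <= 0 + (r.+1 - 1 - r))%N = false by lia.
  by rewrite mul0r.
rewrite mxE /beta /= z /hshift.
have -> : (r.+1 - 1 - r <= 0 + (r.+1 - 1 - r))%N by lia.
rewrite subnn a0 mul1r /cofactor -signr_odd oddD addbb expr0 mul1r.
congr (\det _); apply/matrixP => i j; rewrite !mxE !lift_max.
have e (x : 'I_r) : (r.+1 - 1 - x = (r - 1 - x).+1)%N by have := ltn_ord x; lia.
by rewrite !e addnS ltnS subSS.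
Qed.

Lemma jacobi_trudi_pad r la : (size la <= r)%N ->
  jacobi_trudi r la = jacobi_trudi (size la) la.
Proof.
move=> h; rewrite -(subnKC h); elim: (r - size la)%N => [|d IH]; first by rewrite addn0.
by rewrite addnS jacobi_trudiS // nth_default ?leq_addr.
Qed.

(* Lowering the [j]-th beta number by [k] and moving it to its sorted position
   [m] is a cycle of length [m - j + 1]. *)
Lemma hook_rows_beta_det la nu k j m : is_partition la -> is_partition nu ->
  hook_rows la nu k j m ->
  beta_det (size la) (update (beta (size la) (nth 0%N la)) j (beta (size la) (nth 0%N la) j - k)) =
  (-1) ^+ (m - j) * jacobi_trudi (size la) nu.
Proof.
move=> pla pnu h; have mr := hook_rows_size pla pnu h; have [jm h1 h2 h3 h4] := h.
move: mr; set r := size la; case: r => [//|r] mr.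
have jr : (j < r.+1)%N by lia.
pose J := Ordinal jr; pose M := Ordinal mr.
(* [lift_perm J M 1] sends [j] to [m] and keeps the other rows in order. *)
have -> : (-1 : R) ^+ (m - j) = (-1) ^+ (lift_perm J M 1).
  by rewrite odd_lift_perm odd_perm1 addbF /= -[LHS]signr_odd oddB // addbC.
rewrite /jacobi_trudi /beta_det -det_perm -det_mulmx -row_permE.
congr (\det _); apply/matrixP => x i; rewrite !mxE.
suff -> : update (beta r.+1 (nth 0%N la)) j (beta r.+1 (nth 0%N la) j - k) x =
  beta r.+1 (nth 0%N nu) (lift_perm J M 1 x) by [].
rewrite /update /beta; case: (unliftP J x) => [y|] ->; last first.
  by rewrite lift_perm_id /= eqxx; lia.
rewrite lift_perm_lift perm1 /= /bump; move: (nat_of_ord y) (ltn_ord y) => /= {}y hy.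
case: (leqP j y) => jy /=.
  have -> : (1 + y == j)%N = false by lia.
  case: (leqP m y) => my /=.
    by rewrite h1 //; lia.
  by rewrite add1n add0n -h2; lia.
have -> : (0 + y == j)%N = false by lia.
have -> : (m <= y)%N = false by lia.
by rewrite h1 // jy.
Qed.

(** Rim hooks are grouped by their top row [j]. Each group has at most one member, and it is empty
    exactly when lowering the number [b j] is impossible or gives a zero determinant. *)
Lemma beta_det_rim_hooks la k : is_partition la -> (0 < k)%N ->
  let b := beta (size la) (nth 0%N la) in
  \sum_(j < size la | (k <= b j)%N) beta_det (size la) (update b j (b j - k)) =
  \sum_(nu <- subparts la | rim_hook la nu k)
     (-1) ^+ ht la nu * jacobi_trudi (size nu) nu.
Proof.
move=> pla k0 b.
case: (posnP (size la)) => [la0|lapos].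
  rewrite big1 => [|i _]; last by exfalso; have := leq_ltn_trans (leq0n i) (ltn_ord i); rewrite la0.
  rewrite big1_seq // => nu /andP[hr]; rewrite mem_subparts // => /andP[pnu _].
  have [j [m hk]] := rim_hook_rows pla pnu k0 hr.
  by have := hook_rows_size pla pnu hk; rewrite la0.
(* The top row of the hook, recovered as the first row in which the shapes differ. *)
pose fd (nu : seq nat) := find (fun i => nth 0 nu i < nth 0 la i)%N (iota 0 (size la)).
have fdE nu j m : is_partition nu -> hook_rows la nu k j m -> fd nu = j.
  move=> pnu h; have mr := hook_rows_size pla pnu h; have lt := hook_rows_lt pla pnu h.
  have [jm h1 _ _ _] := h.
  have jr : (j < size la)%N by lia.
  have hs : has (fun i => nth 0 nu i < nth 0 la i)%N (iota 0 (size la)).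
    by apply/hasP; exists j; [rewrite mem_iota | apply: lt; lia].
  have := nth_find 0%N hs; rewrite -/(fd nu).
  have fr : (fd nu < size la)%N by move: hs; rewrite has_find size_iota.
  rewrite nth_iota // add0n => hf.
  case: (ltngtP (fd nu) j) => // c.
    by move: hf; rewrite h1 ?c // ltnn.
  have := before_find 0%N c; rewrite nth_iota // add0n lt //; lia.
have x0 : 'I_(size la) := Ordinal lapos.
pose fo nu : 'I_(size la) := insubd x0 (fd nu).
have foE nu j m : is_partition nu -> hook_rows la nu k j m -> fo nu = j :> nat.
  move=> pnu h; rewrite /fo val_insubd (fdE _ _ _ pnu h).
  by have := hook_rows_size pla pnu h; case: h => jm _ _ _ _ mr; rewrite (leq_ltn_trans jm mr).
rewrite [RHS](partition_big fo predT) //= big_mkcond; apply: eq_bigr => j _.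
case: (boolP (has (fun nu => rim_hook la nu k && (fo nu == j)) (subparts la))) => [|hno].
  move=> /hasP[nu nus /andP[hr /eqP fj]].
  have /andP[pnu sub] : is_partition nu && subdiag nu la by rewrite -mem_subparts.
  have [j' [m hk]] := rim_hook_rows pla pnu k0 hr.
  have ej := foE _ _ _ pnu hk; rewrite fj in ej; rewrite -ej in hk.
  have -> : (k <= b j)%N.
    by have := hook_rows_size pla pnu hk; case: hk => jm _ _ _ e; rewrite /b /beta; lia.
  rewrite (hook_rows_beta_det pla pnu hk) big_mkcond (bigD1_seq nu) ?uniq_subparts //=.
  rewrite hr fj eqxx /= (hook_rows_ht pla pnu hk) jacobi_trudi_pad; last by case/andP: sub.
  rewrite big1_seq ?addr0 // => nu' /andP[nn]; rewrite mem_subparts // => /andP[pnu' _].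
  case: ifP => // /andP[hr' /eqP fj'].
  have [j'' [m' hk']] := rim_hook_rows pla pnu' k0 hr'.
  have ej' := foE _ _ _ pnu' hk'; rewrite fj' in ej'; rewrite -ej' in hk'.
  by rewrite (hook_rows_unique pla pnu' pnu hk' hk) eqxx in nn.
rewrite big_hasC //; case: ifP => // kb.
(* A nonzero determinant has no repeated beta number, so a hook with top row [j] would exist. *)
apply/eqP; rewrite -[_ == _]negbK; apply/negP => nz.
have [] := @hook_rows_exists la k j pla k0 (ltn_ord j) kb.
  move=> i ir ij e; case/negP: nz; apply/eqP.
  apply: (@beta_det_repeat _ _ j i) => //; first by move=> e'; apply: ij.
  rewrite /update eqxx; have -> : (i == j :> nat) = false by apply/eqP.
  by rewrite /b /beta; lia.
move=> nu [m [pnu hk]]; case/negP: hno; apply/hasP; exists nu.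
  by rewrite mem_subparts // pnu (hook_rows_subdiag pla pnu hk).
rewrite (hook_rows_rim_hook pla pnu hk) /=; apply/eqP/val_inj; exact: foE pnu hk.
Qed.

Lemma jacobi_trudi_rec (p : nat -> R) la :
  (forall m, m%:R * a m = \sum_(1 <= k < m.+1) p k * a (m - k)%N) -> is_partition la ->
  (sumn la)%:R * jacobi_trudi (size la) la =
  \sum_(1 <= k < (sumn la).+1) p k * \sum_(nu <- subparts la | rim_hook la nu k)
     (-1) ^+ ht la nu * jacobi_trudi (size nu) nu.
Proof.
move=> rec pla; set r := size la; pose b := beta r (nth 0%N la).
(* A common strict bound for all beta numbers. *)
pose K := (sumn la + r).+1.
have bK j : (j < r)%N -> (b j < K)%N.
  move=> jr; rewrite /b /beta /K (sumn_big (leqnn r)) (bigD1 (Ordinal jr)) //=; lia.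
have := beta_det_rec rec bK.
have -> : (\sum_(j < r) b j = sumn la + \sum_(j < r) (r - 1 - j))%N.
  by rewrite (sumn_big (leqnn r)) -big_split.
rewrite natrD addrK => <-.
rewrite (@big_cat_nat _ _ _ (sumn la).+1) //=; last by rewrite /K; lia.
rewrite [X in _ + X]big_nat_cond [X in _ + X]big1 ?addr0 => [|k /andP[/andP[hk _] _]].
  rewrite [LHS]big_nat_cond [RHS]big_nat_cond; apply: eq_bigr => k /andP[/andP[hk _] _].
  by rewrite -beta_det_rim_hooks.
(* The remaining [k] exceed the size of [la], so no rim hook has this size. *)
rewrite beta_det_rim_hooks //; last by lia.
rewrite big1 ?mulr0 // => nu /and5P[_ _ /eqP e _ _]; lia.
Qed.

End BetaDet.

(** * Standard tableaux *)

Lemma card_can_in (T1 T2 : finType) (A : {set T1}) (B : {set T2}) (f : T1 -> T2) (g : T2 -> T1) :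
  (forall x, x \in A -> f x \in B) -> (forall y, y \in B -> g y \in A) ->
  {in A, cancel f g} -> {in B, cancel g f} -> #|A| = #|B|.
Proof.
move=> fB gA fK gK; rewrite -(card_in_imset (can_in_inj fK)); congr #|pred_of_set _|.
apply/setP => y; apply/imsetP/idP => [[x xA ->]|yB]; first exact: fB.
by exists (g y); [apply: gA | rewrite gK].
Qed.

(* Fillings of different shapes have different types; they are compared as total
   functions on [nat * nat], with value 0 outside the diagram. *)
Definition total_syt (la : seq nat) (g : nat -> nat -> nat) : Prop :=
  [/\ forall i j, (nth 0 la i <= j)%N -> g i j = 0%N,
      forall i j, (j < nth 0 la i)%N -> (0 < g i j <= sumn la)%N,
      forall i j i' j', (j < nth 0 la i)%N -> (j' < nth 0 la i')%N ->
        g i j = g i' j' -> i = i' /\ j = j',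
      forall i j, (j.+1 < nth 0 la i)%N -> (g i j < g i j.+1)%N
    & forall i j, (j < nth 0 la i.+1)%N -> (g i j < g i.+1 j)%N].

Definition filling (la : seq nat) : finType :=
  {ffun 'I_(size la) * 'I_(head 0%N la) -> 'I_(sumn la).+1}.

Definition filling_val la (t : filling la) (i j : nat) : nat :=
  if insub i is Some x then if insub j is Some y then t (x, y) else 0%N else 0%N.

Definition mk_filling la (g : nat -> nat -> nat) : filling la :=
  [ffun p : 'I_(size la) * 'I_(head 0%N la) => inord (g p.1 p.2)].

Section Fillings.
Variable la : seq nat.
Hypothesis pla : is_partition la.

Lemma filling_valE (t : filling la) (x : 'I_(size la)) (y : 'I_(head 0%N la)) :
  filling_val t x y = t (x, y).
Proof. by rewrite /filling_val !valK. Qed.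

Lemma filling_val_in (t : filling la) i j : (j < nth 0 la i)%N ->
  exists (x : 'I_(size la)) (y : 'I_(head 0%N la)),
    [/\ i = x, j = y & filling_val t i j = t (x, y)].
Proof.
move=> h; have hi : (i < size la)%N by rewrite -partition_nth_gt0 //; lia.
have hj : (j < head 0%N la)%N by apply: leq_trans h _; apply: partition_head.
by exists (Ordinal hi), (Ordinal hj); split=> //; rewrite -filling_valE.
Qed.

Lemma is_sytP (t : filling la) : reflect (total_syt la (filling_val t)) (is_syt la t).
Proof.
have cE (p : 'I_(size la) * 'I_(head 0%N la)) : skew_cell la [::] p.1 p.2 = (p.2 < nth 0 la p.1)%N.
  by rewrite /skew_cell nth_nil.
apply: (iffP idP) => [/andP[/andP[/andP[/forallP h1 /forallP h2] /forallP h3] /forallP h4]|].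
- split.
  + move=> i j hij; rewrite /filling_val; case: insubP => [x _ ex|//]; case: insubP => [y _ ey|//].
    have := h1 (x, y); rewrite cE /= ex ey -leqNgt hij /= => /eqP ->; by [].
  + move=> i j hij; have [x [y [ex ey ->]]] := filling_val_in t hij.
    have := h2 (x, y); rewrite cE /= -ex -ey hij /= => ->.
    by rewrite -ltnS ltn_ord.
  + move=> i j i' j' hij hij'.
    have [x [y [ex ey ->]]] := filling_val_in t hij.
    have [x' [y' [ex' ey' ->]]] := filling_val_in t hij' => e.
    have := forallP (h3 (x, y)) (x', y'); rewrite !cE /= -ex -ex' -ey -ey' hij hij' /=.
    by move/implyP; rewrite -val_eqE /= e eqxx => /(_ isT) /eqP [exx eyy]; split; rewrite ?ex ?ex' ?ey ?ey' ?exx ?eyy.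
  + move=> i j hij; have hij' : (j < nth 0 la i)%N by lia.
    have [x [y [ex ey ->]]] := filling_val_in t hij'.
    have [x' [y' [ex' ey' ->]]] := filling_val_in t hij.
    have := forallP (h4 (x, y)) (x', y'); rewrite !cE /= -ex -ex' -ey -ey' hij hij' /=.
    have -> : x = x' by apply: val_inj; rewrite /= -ex -ex'.
    by rewrite !eqxx.
  + move=> i j hij; have hij' : (j < nth 0 la i)%N.
      by apply: leq_trans hij _; apply: partition_nonincreasing.
    have [x [y [ex ey ->]]] := filling_val_in t hij'.
    have [x' [y' [ex' ey' ->]]] := filling_val_in t hij.
    have := forallP (h4 (x, y)) (x', y'); rewrite !cE /= -ex -ex' -ey -ey' hij hij' /=.
    have -> : y = y' by apply: val_inj; rewrite /= -ey -ey'.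
    by rewrite !eqxx orbT.
- move=> [h1 h2 h3 h4 h5]; apply/andP; split; first (apply/andP; split; first (apply/andP; split)).
  + apply/forallP => -[x y]; rewrite cE -leqNgt; apply/implyP => h.
    by rewrite -val_eqE /= -filling_valE h1.
  + apply/forallP => -[x y]; rewrite cE; apply/implyP => h.
    by rewrite -filling_valE; case/andP: (h2 _ _ h).
  + apply/forallP => -[x y]; apply/forallP => -[x' y']; rewrite !cE.
    apply/implyP => h; apply/implyP => h'; apply/implyP => /eqP e.
    have [] := h3 _ _ _ _ h h'; first by rewrite !filling_valE e.
    by move=> /= /val_inj -> /val_inj ->.
  + apply/forallP => -[x y]; apply/forallP => -[x' y']; rewrite !cE -!filling_valE /=.
    apply/implyP => h; apply/implyP => h'; apply/implyP => /orP[/andP[/eqP ex /eqP ey]|/andP[/eqP ey /eqP ex]].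
      by rewrite -ex -ey; apply: h4; rewrite ex ey.
    by rewrite -ex -ey; apply: h5; rewrite ex ey.
Qed.

Lemma mk_fillingK (g : nat -> nat -> nat) i j :
  total_syt la g -> filling_val (mk_filling la g) i j = g i j.
Proof.
move=> [h1 h2 _ _ _]; case: (ltnP j (nth 0%N la i)) => h.
  have [x [y [ex ey ->]]] := filling_val_in (mk_filling la g) h.
  rewrite ffunE /= -ex -ey inordK // ltnS; by case/andP: (h2 _ _ h).
rewrite (h1 _ _ h) /filling_val; case: insubP => [x _ ex|//]; case: insubP => [y _ ey|//].
by rewrite ffunE /= ex ey h1 // inordK.
Qed.

Lemma filling_valK (t : filling la) : mk_filling la (filling_val t) = t.
Proof. by apply/ffunP => -[x y]; rewrite ffunE /= filling_valE inord_val. Qed.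

Lemma eq_mk_filling g g' : (forall i j, g i j = g' i j) -> mk_filling la g = mk_filling la g'.
Proof. by move=> h; apply/ffunP => p; rewrite !ffunE h. Qed.

Lemma total_syt_ext g g' : (forall i j, g i j = g' i j) -> total_syt la g -> total_syt la g'.
Proof.
move=> e [h1 h2 h3 h4 h5]; split.
- by move=> i j; rewrite -e; apply: h1.
- by move=> i j; rewrite -e; apply: h2.
- by move=> i j i' j'; rewrite -!e; apply: h3.
- by move=> i j; rewrite -!e; apply: h4.
- by move=> i j; rewrite -!e; apply: h5.
Qed.

Lemma card_cells :
  #|[set p : 'I_(size la) * 'I_(head 0%N la) | (p.2 < nth 0 la p.1)%N]| = sumn la.
Proof.
rewrite -sum1dep_card.
rewrite -(pair_big_dep xpredT (fun (i : 'I_(size la)) (j : 'I_(head 0%N la)) => (j < nth 0 la i)%N) (fun _ _ => 1%N)) /=.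
rewrite (sumn_big (leqnn _)); apply: eq_bigr => i _.
rewrite -(big_mkord (fun j => (j < nth 0 la i)%N) (fun _ => 1%N)).
rewrite -(@big_nat_widen _ _ _ _ _ _ xpredT) ?partition_head //.
by rewrite sum_nat_const_nat subn0 muln1.
Qed.

(** The entries map the [n] cells injectively into [{1, ..., n}], hence onto it. *)
Lemma syt_max_cell (t : filling la) : (0 < sumn la)%N -> is_syt la t ->
  exists i j, (j < nth 0 la i)%N /\ filling_val t i j = sumn la.
Proof.
move=> n0 /is_sytP [h1 h2 h3 _ _].
pose C := [set p : 'I_(size la) * 'I_(head 0%N la) | (p.2 < nth 0 la p.1)%N].
have inj : {in C &, injective t}.
  move=> [x y] [x' y']; rewrite !inE /= => c c' e.
  have [] := h3 _ _ _ _ c c'; first by rewrite !filling_valE e.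
  by move=> /= /val_inj -> /val_inj ->.
have sub : t @: C \subset [set~ ord0].
  apply/subsetP => v /imsetP[[x y]]; rewrite !inE /= => c ->.
  by rewrite -val_eqE /= -filling_valE -lt0n; case/andP: (h2 _ _ c).
have : t @: C == [set~ ord0].
  by rewrite eqEcard sub cardsC1 card_ord (card_in_imset inj) card_cells /=.
move=> /eqP /setP /(_ ord_max); rewrite !inE -val_eqE /= -lt0n n0 => /imsetP[[x y]].
by rewrite inE /= => c e; exists x, y; split=> //; rewrite filling_valE -e.
Qed.

End Fillings.

(** * Removing the cell with the largest entry *)

Section RemoveCorner.
Variables (la mu : seq nat) (m : nat).

Definition restrict_shape (g : nat -> nat -> nat) (i j : nat) : nat :=
  if (j < nth 0 mu i)%N then g i j else 0%N.

Definition extend_shape (g : nat -> nat -> nat) (i j : nat) : nat :=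
  if (j < nth 0 mu i)%N then g i j else if (j < nth 0 la i)%N then sumn la else 0%N.

(** For a tableau this says that the largest entry lies in [la / mu], because that entry occurs
    somewhere. *)
Definition avoids_max (t : filling la) : bool :=
  [forall p : 'I_(size la) * 'I_(head 0%N la),
     (p.2 < nth 0 mu p.1)%N ==> (t p != sumn la :> nat)].

Hypotheses (pla : is_partition la) (pmu : is_partition mu) (hk : hook_rows la mu 1 m m).

Let mu_out i : i <> m -> nth 0%N mu i = nth 0%N la i.
Proof. by case: hk => _ h _ _ _ im; apply: h; lia. Qed.
Let mu_m : (nth 0%N mu m).+1 = nth 0%N la m.
Proof. by case: hk => _ _ _ _ e; lia. Qed.
Let mu_le i : (nth 0 mu i <= nth 0 la i)%N.
Proof. by case: (eqVneq i m) => [->|/eqP /mu_out ->]; rewrite -?mu_m. Qed.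
Let sum_mu : sumn la = (sumn mu).+1.
Proof. by rewrite (hook_rows_sumn pla pmu hk) addn1. Qed.
Let diff i j : (nth 0 mu i <= j)%N -> (j < nth 0 la i)%N -> i = m /\ j = nth 0%N mu m.
Proof.
case: (eqVneq i m) => [->|/eqP /mu_out ->]; last by lia.
by rewrite -mu_m => a b; split=> //; lia.
Qed.

Lemma avoids_maxP (t : filling la) :
  reflect (forall i j, (j < nth 0 mu i)%N -> filling_val t i j <> sumn la) (avoids_max t).
Proof.
apply: (iffP forallP) => [h i j hij|h [x y]].
  have [x [y [ex ey ->]]] := filling_val_in pla t (leq_trans hij (mu_le i)).
  by have := h (x, y); rewrite /= -ex -ey hij /= => /eqP.
by apply/implyP => hxy; rewrite -filling_valE; apply/eqP/h.
Qed.

Lemma restrict_syt g : total_syt la g -> (forall i j, (j < nth 0 mu i)%N -> g i j <> sumn la) ->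
  total_syt mu (restrict_shape g).
Proof.
move=> [h1 h2 h3 h4 h5] hn.
have lt i j : (j < nth 0 mu i)%N -> (j < nth 0 la i)%N by move/leq_trans; apply.
have mS i : (nth 0 mu i.+1 <= nth 0 mu i)%N by apply: partition_nonincreasing.
rewrite /restrict_shape; split.
- by move=> i j; rewrite leqNgt => /negbTE ->.
- by move=> i j hij; rewrite hij; have := h2 i j (lt _ _ hij); have := hn _ _ hij; rewrite sum_mu; lia.
- by move=> i j i' j' hij hij'; rewrite hij hij'; apply: h3; apply: lt.
- by move=> i j hij; rewrite hij (ltnW hij); apply: h4; apply: lt.
- by move=> i j hij; rewrite hij (leq_trans hij (mS i)); apply: h5; apply: lt.
Qed.

(** The cell of [la / mu] has no cell of [la] to its right or below it, so its entry, the largest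
    one, never has to be the smaller of two. *)
Lemma extend_syt g : total_syt mu g -> total_syt la (extend_shape g).
Proof.
move=> [h1 h2 h3 h4 h5].
have mS i : (nth 0 mu i.+1 <= nth 0 mu i)%N by apply: partition_nonincreasing.
have laS i : (nth 0 la i.+1 <= nth 0 la i)%N by apply: partition_nonincreasing.
rewrite /extend_shape; split.
- move=> i j hij; have -> : (j < nth 0 mu i)%N = false by have := mu_le i; lia.
  by have -> : (j < nth 0 la i)%N = false by lia.
- move=> i j hij; rewrite hij; case: ifP => [/h2|_]; rewrite sum_mu; lia.
- move=> i j i' j' hij hij'; rewrite hij hij'; case: ifP => c; case: ifP => c'.
  + exact: h3.
  + by have := h2 _ _ c; rewrite sum_mu; lia.
  + by have := h2 _ _ c'; rewrite sum_mu; lia.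
  + move=> _; have [-> ->] := diff (i := i) (j := j) (ltac:(lia)) hij.
    by have [-> ->] := diff (i := i') (j := j') (ltac:(lia)) hij'.
- move=> i j hij; have c : (j < nth 0 mu i)%N.
    rewrite ltnNge; apply/negP => hm.
    have [_ e1] := diff hm (ltnW hij); have [_ e2] := diff (leq_trans hm (leqnSn j)) hij; lia.
  rewrite c hij; case: ifP => [|_]; first exact: h4.
  by have := h2 _ _ c; rewrite sum_mu; lia.
- move=> i j hij; have hij' := leq_trans hij (laS i); have c : (j < nth 0 mu i)%N.
    rewrite ltnNge; apply/negP => hm; have [e1 e2] := diff hm hij'.
    have := mS m; rewrite (mu_out (i := m.+1)); last by lia.
    by rewrite e1 e2 in hij; lia.
  rewrite c hij; case: ifP => [|_]; first exact: h5.
  by have := h2 _ _ c; rewrite sum_mu; lia.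
Qed.

Lemma card_avoids_max : #|[set t : filling la | is_syt la t && avoids_max t]| = F mu.
Proof.
have n0 : (0 < sumn la)%N by rewrite sum_mu.
pose f (t : filling la) := mk_filling mu (restrict_shape (filling_val t)).
pose g (t : filling mu) := mk_filling la (extend_shape (filling_val t)).
have fv (t : filling la) : is_syt la t && avoids_max t ->
    total_syt mu (restrict_shape (filling_val t)).
  by move=> /andP[/(is_sytP pla) h /avoids_maxP h']; apply: restrict_syt.
have gv (t : filling mu) : is_syt mu t -> total_syt la (extend_shape (filling_val t)).
  by move=> /(is_sytP pmu) h; apply: extend_syt.
apply: (@card_can_in _ _ _ _ f g) => [t|t|t|t]; rewrite !inE => ht.
- apply/(is_sytP pmu); apply: total_syt_ext (fv t ht) => i j.
  by rewrite mk_fillingK //; apply: fv.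
- apply/andP; split.
    apply/(is_sytP pla); apply: total_syt_ext (gv t ht) => i j.
    by rewrite mk_fillingK //; apply: gv.
  apply/avoids_maxP => i j hij; rewrite mk_fillingK //; last exact: gv.
  rewrite /extend_shape hij; case/(is_sytP pmu): ht => _ h _ _ _.
  by have := h _ _ hij; rewrite sum_mu; lia.
- rewrite -[RHS]filling_valK; apply: eq_mk_filling => i j.
  rewrite /extend_shape mk_fillingK //; last exact: fv.
  rewrite /restrict_shape; case: ltnP => // c; case: ifP => d.
    (* The largest entry occurs but avoids [mu], so it sits in the only cell of [la / mu]. *)
    have [ei ej] := diff c d.
    case/andP: ht => ht /avoids_maxP av.
    have [i' [j' [c' e]]] := syt_max_cell pla n0 ht.
    case: (ltnP j' (nth 0%N mu i')) => c''; first by have := av _ _ c''.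
    by have [ei' ej'] := diff c'' c'; rewrite -e ei ej ei' ej'.
  by case/andP: ht => /(is_sytP pla) [h1 _ _ _ _] _; rewrite h1 // leqNgt d.
- rewrite -[RHS]filling_valK; apply: eq_mk_filling => i j.
  rewrite /restrict_shape mk_fillingK //; last exact: gv.
  rewrite /extend_shape; case: ltnP => // c.
  by case/(is_sytP pmu): ht => h _ _ _ _; rewrite h.
Qed.
End RemoveCorner.

(** Count pairs of a tableau and a covered [mu] that avoids its largest entry; each tableau has
    exactly one such [mu]. *)
Lemma F_rec la : is_partition la -> (0 < sumn la)%N ->
  F la = (\sum_(mu <- subparts la | covers la mu) F mu)%N.
Proof.
move=> pla n0.
have pm mu : covers la mu -> is_partition mu by case/andP => /andP[].
transitivity (\sum_(mu <- subparts la | covers la mu)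
   \sum_(t : filling la | is_syt la t && avoids_max mu t) 1)%N; last first.
  apply: eq_bigr => mu hc; have [m hk] := covers_hook_rows pla hc.
  by rewrite -(card_avoids_max pla (pm _ hc) hk) -sum1dep_card.
rewrite (exchange_big_dep (fun t : filling la => is_syt la t)) /=; last first.
  by move=> mu t _ /andP[].
rewrite /F -sum1dep_card; apply: eq_bigr => t ht.
have [i [j [c e]]] := syt_max_cell pla n0 ht.
have [h1 h2 h3 h4 h5] := elimT (is_sytP pla t) ht.
have laS x : (nth 0 la x.+1 <= nth 0 la x)%N by apply: partition_nonincreasing.
(* Entries increase, so the cell of the largest entry ends its row and its column: it is a
   corner. *)
have ej : nth 0%N la i = j.+1.
  apply/eqP; rewrite eqn_leq c andbT leqNgt; apply/negP => lt.
  by have := h4 _ _ lt; have := h2 _ _ lt; rewrite e; lia.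
have eS : (nth 0 la i.+1 <= j)%N.
  rewrite leqNgt; apply/negP => lt; have := h5 _ _ lt; have := h2 _ _ lt; rewrite e; lia.
have ir : (i < size la)%N by rewrite -partition_nth_gt0 // ej.
pose l x := if x == i then j else nth 0%N la x.
have lS x : (x.+1 < size la)%N -> (l x.+1 <= l x)%N.
  move=> _; rewrite /l; have := laS x; case: (eqVneq x i) => [->|ne].
    by have -> : (i.+1 == i) = false by lia.
  by case: (eqVneq x.+1 i) => [->|ne']; lia.
pose mu := shape_of (size la) l.
have muE x : nth 0%N mu x = l x.
  rewrite nth_shape_of //; case: ltnP => // h; rewrite /l.
  by rewrite gtn_eqF ?nth_default //; apply: leq_trans h.
have pmu : is_partition mu by apply: is_partition_shape_of.
have hk : hook_rows la mu 1 i i.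
  split; rewrite ?muE /l ?eqxx ?ej ?addn0 ?addn1 //.
  - by move=> x hx; rewrite muE /l; case: eqP => // xi; rewrite xi ltnn in hx.
  - by move=> x; rewrite ltnNge; case: (i <= x)%N.
have hc : covers la mu by rewrite -rim_hook1 //; apply: hook_rows_rim_hook hk.
have av : avoids_max mu t.
  apply/(avoids_maxP pla pmu hk) => x y; rewrite muE /l => hxy e'.
  have hxy' : (y < nth 0 la x)%N by move: hxy; case: eqP => [->|]; lia.
  have [] := h3 _ _ _ _ hxy' c; first by rewrite e e'.
  by move=> ex ey; move: hxy; rewrite ex eqxx; lia.
rewrite big_mkcond (bigD1_seq mu) ?uniq_subparts //=; last first.
  by rewrite mem_subparts // pmu (hook_rows_subdiag pla pmu hk).
rewrite hc ht av /= big1_seq ?addn0 // => mu' /andP[ne _].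
case: ifP => // /andP[hc' av'].
have [m' hk'] := covers_hook_rows pla hc'; have pmu' := pm _ hc'.
(* If [mu'] lost a cell in another row, it would still contain the cell of the largest entry. *)
suff em : m' = i by move: ne; rewrite (hook_rows_unique pla pmu' pmu (eq_ind _ (fun x => hook_rows la mu' 1 x x) hk' _ em) hk) eqxx.
have /(avoids_maxP pla pmu' hk') av'' := av'.
case: (ltnP j (nth 0%N mu' i)) => h; first by have := av'' _ _ h.
apply/eqP; rewrite -[_ == _]negbK; apply/negP => nm.
case: hk' => _ h' _ _ _; have := h' i; lia.
Qed.

(** * The recurrence for Appell polynomials *)

Lemma coef_exp_trunc (R : nzRingType) (p q : {poly R}) k m :
  (forall j, (j <= k)%N -> p`_j = q`_j) -> forall j, (j <= k)%N -> (p ^+ m)`_j = (q ^+ m)`_j.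
Proof.
move=> h; elim: m => [|m IH] j hj; first by rewrite !expr0.
rewrite !exprS !coefM; apply: eq_bigr => i _; have := ltn_ord i => hi.
by rewrite h ?IH //; lia.
Qed.

Lemma coef_exp_small (R : nzRingType) (p : {poly R}) m k :
  p`_0 = 0 -> (k < m)%N -> (p ^+ m)`_k = 0.
Proof.
move=> p0; elim: m k => [//|m IH] k km; rewrite exprS coefM big1 // => i _.
case: (posnP i) => [->|i0]; first by rewrite p0 mul0r.
by rewrite IH ?mulr0 //; have := ltn_ord i; lia.
Qed.

Section CharZero.
Variables (R : fieldType) (charR : [pchar R] =i pred0).

Lemma natr_neq0 n : (0 < n)%N -> n%:R != 0 :> R.
Proof. by move=> n0; rewrite (GRing.pcharf0P R).1 // -lt0n. Qed.

Lemma fact_neq0 n : (n`!)%:R != 0 :> R.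
Proof. by rewrite natr_neq0 ?fact_gt0. Qed.

Lemma poly_deriv0 (p : {poly R}) : p^`() = 0 -> p.[0] = 0 -> p = 0.
Proof.
move=> d0 h0; apply/polyP => -[|i]; rewrite coef0; first by rewrite -horner_coef0.
have := coef_deriv p i; rewrite d0 coef0 => /esym/eqP.
by rewrite -mulr_natr mulf_eq0 (negbTE (natr_neq0 (ltn0Sn i))) orbF => /eqP.
Qed.

Section Appell.
Variable A : nat -> {poly R}.
Hypothesis HA : appell A.

Definition appell_const m : R := (A m).[0] / (m`!)%:R.
Definition scaled_appell m : {poly R} := (m`!)%:R^-1 *: A m.
(** The coefficient of [t^(k-1)] in the derivative of [log f_A]. *)
Definition log_sum k : R := cA A k / (k.-1`!)%:R.

Lemma appell_const0 : appell_const 0 = 1.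
Proof. by rewrite /appell_const HA.1 hornerE fact0 divr1. Qed.

Lemma coef_fA_trunc N j :
  (fA_trunc A N)`_j = if (0 < j <= N)%N then appell_const j else 0.
Proof.
rewrite /fA_trunc coef_sum; case: ifP => h.
  rewrite (bigD1_seq j) ?iota_uniq ?mem_index_iota //=.
  rewrite coefZ coefXn eqxx mulr1 big1 ?addr0 // => i ij.
  by rewrite coefZ coefXn eq_sym (negbTE ij) mulr0.
rewrite big1_seq // => i /andP[_]; rewrite mem_index_iota => hi.
rewrite coefZ coefXn; case: eqP => [e|]; rewrite ?mulr0 //; lia.
Qed.

Let lg N : {poly R} := \sum_(1 <= m < N.+1) ((-1) ^+ m.+1 / m%:R) *: (fA_trunc A N) ^+ m.

(** With [u = f_A - 1] truncated, [u] has no constant term, so [u^m] with [m > k] does not reach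
    degree [k], and neither do terms of [u] beyond degree [k]. *)
Let lg_coef N k : (k <= N)%N -> (lg N)`_k = (lg k)`_k.
Proof.
move=> kN; rewrite !coef_sum (@big_cat_nat _ _ _ k.+1) //= [X in _ + X]big1_seq ?addr0.
  rewrite big_nat_cond [RHS]big_nat_cond; apply: eq_bigr => m hm.
  rewrite !coefZ (@coef_exp_trunc _ _ (fA_trunc A k) k) // => j jk.
  by rewrite !coef_fA_trunc; congr (if _ then _ else _); lia.
move=> m; rewrite mem_index_iota => hm.
by rewrite coefZ coef_exp_small ?mulr0 ?coef_fA_trunc //; lia.
Qed.

(** The derivative of the truncated logarithm is [u'] times a finite geometric sum in [-u], which
    [1 + u] telescopes. *)
Let lg_deriv N : (1 + fA_trunc A N) * (lg N)^`() =
  (fA_trunc A N)^`() * (1 - (- fA_trunc A N) ^+ N).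
Proof.
set u := fA_trunc A N.
have -> : (lg N)^`() = u^`() * \sum_(i < N) (- u) ^+ i.
  rewrite /lg big_add1 /= raddf_sum -(big_mkord xpredT (fun i => (- u) ^+ i)) mulr_sumr.
  apply: eq_bigr => i _; rewrite /= derivZ deriv_exp -/u.
  rewrite -scaler_nat scalerA divfK ?natr_neq0 // /= [(- u) ^+ i]exprNn mulrCA -mul_polyC.
  by rewrite polyC_exp polyCN polyC1 !exprS !mulN1r opprK.
have := subrX1 (- u) N; rewrite mulrCA => e.
have -> : (1 + u) * (\sum_(i < N) (- u) ^+ i) = - ((- u) ^+ N - 1).
  by rewrite e -mulNr opprB opprK.
by rewrite opprB.
Qed.

(* The coefficient of [t ^ (m - 1)] in [f_A' = f_A * (log f_A)']. *)
Lemma appell_const_rec m :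
  m%:R * appell_const m = \sum_(1 <= k < m.+1) log_sum k * appell_const (m - k)%N.
Proof.
case: m => [|N]; first by rewrite mul0r big_geq.
(* At truncation order [N+1] the error term has the factor [(-u)^(N+1)], which does not contribute
   to degree [N]. *)
have := congr1 (fun p : {poly R} => p`_N) (lg_deriv N.+1).
rewrite mulrBr mulr1 coefB [X in _ - X]coefM [X in _ - X]big1 ?subr0 => [|i _]; last first.
  by rewrite coef_exp_small ?mulr0 ?coefN ?coef_fA_trunc ?oppr0 //; have := ltn_ord i; lia.
rewrite coef_deriv coef_fA_trunc ltn0Sn leqnn /= mulr_natl => <-.
rewrite coefMr big_add1 /= big_mkord; apply: eq_bigr => i _.
have := ltn_ord i => hi.
rewrite coef_deriv lg_coef // mulrC subSS; congr (_ * _).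
  rewrite /log_sum /cA -/(lg i.+1) factS natrM /= -mulr_natr.
  by field; rewrite fact_neq0.
rewrite coefD coef1 coef_fA_trunc; case: (posnP (N - i)) => [->|h].
  by rewrite /= addr0 appell_const0.
by rewrite /= add0r; have -> : (N - i <= N.+1)%N by lia.
Qed.

Lemma deriv_scaled_appell m : (scaled_appell m.+1)^`() = scaled_appell m.
Proof.
rewrite /scaled_appell derivZ HA.2 scalerA factS natrM invfM mulrAC mulVf ?mul1r //.
exact: natr_neq0.
Qed.

Lemma scaled_appell0 : scaled_appell 0 = 1.
Proof. by rewrite /scaled_appell HA.1 fact0 invr1 scale1r. Qed.

(** The coefficient of [t^(k-1)] in the [t]-derivative of [x t + log f_A(t)]. *)
Definition appell_psum k : {poly R} := (if k == 1%N then 'X else 0) + (log_sum k)%:P.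

(** Induction on [m]: the [x]-derivative of the difference of the two sides vanishes by the
    induction hypothesis, and its value at 0 by [appell_const_rec]. *)
Lemma scaled_appell_rec m :
  m%:R * scaled_appell m = \sum_(1 <= k < m.+1) appell_psum k * scaled_appell (m - k)%N.
Proof.
elim: m => [|m IH]; first by rewrite mul0r big_geq.
apply/eqP; rewrite -subr_eq0; apply/eqP; apply: poly_deriv0.
  rewrite derivB -polyC_natr derivM derivC mul0r add0r deriv_scaled_appell raddf_sum.
  have psum' k : (appell_psum k)^`() = (k == 1%N)%:R.
    by rewrite derivD derivC addr0; case: eqP; rewrite ?derivX ?deriv0.
  under [X in _ - X]eq_bigr do rewrite /= derivM psum'.
  (* Only [p_1] depends on [x]; its derivative 1 supplies the extra [a_m] that turns [m a_m] into
     [(m+1) a_m]. *)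
  rewrite big_split /= big_ltn // subSS subn0 eqxx mul1r [X in _ + X + _]big1_seq ?addr0.
    rewrite big_nat_recr //= subnn scaled_appell0 [1^`()]derivC mulr0 addr0.
    rewrite polyC_natr -natr1 mulrDl mul1r IH; apply/eqP; rewrite subr_eq0 addrC; apply/eqP; congr (_ + _).
    apply: eq_big_nat => k /andP[_ hk].
    by rewrite subSn ?deriv_scaled_appell // -ltnS.
  move=> k; rewrite mem_index_iota => hk; have -> : (k == 1%N) = false by lia.
  by rewrite mul0r.
rewrite hornerD hornerN -polyC_natr hornerM hornerC horner_sum.
apply/eqP; rewrite subr_eq0; apply/eqP.
have h0 k : (scaled_appell k).[0] = appell_const k.
  by rewrite /scaled_appell hornerZ mulrC.
rewrite h0 appell_const_rec; apply: eq_bigr => k _.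
rewrite hornerM h0 hornerD hornerC; congr (_ * _).
by case: ifP => _; rewrite ?hornerX ?horner0 add0r.
Qed.

End Appell.
End CharZero.

(** * Wronskians and Vandermonde determinants *)

Lemma nseqp_lt la i j : is_partition la -> (i < j)%N -> (nseqp la i < nseqp la j)%N.
Proof.
move=> pla ij; rewrite /nseqp.
have : (nth 0 la (size la - 1 - i) <= nth 0 la (size la - 1 - j))%N.
  by apply: partition_nonincreasing => //; lia.
by lia.
Qed.

(** The [n_j] are the beta numbers in reverse order. Transposing and reversing both rows and columns
    relates the matrices, and the two signs cancel. *)
Lemma det_nseqp (R : comNzRingType) (a : nat -> R) la :
  \det (\matrix_(i < size la, j < size la) hshift a (nseqp la j) i) =
  jacobi_trudi a (size la) la.
Proof.
set r := size la; set Q := \matrix_(i, j) _.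
pose s : 'S_r := perm (@rev_ord_inj r).
have -> : jacobi_trudi a r la = \det (row_perm s (col_perm s Q^T)).
  congr (\det _); apply/matrixP => j i; rewrite !mxE !permE /= /nseqp /beta -/r.
  have := ltn_ord j => jr; have -> : (r - 1 - (r - j.+1) = j)%N by lia.
  by congr (hshift a (_ + _) _); lia.
rewrite row_permE col_permE !det_mulmx !det_perm det_tr odd_permV mulrCA.
by rewrite -signr_addb addbb mulr1.
Qed.

Lemma det_scaled_nseqp (R : comNzRingType) (a c : nat -> R) la :
  \det (\matrix_(i < size la, j < size la) (hshift a (nseqp la j) i * c (nseqp la j))) =
  jacobi_trudi a (size la) la * \prod_(j < size la) c (nseqp la j).
Proof.
have -> : \prod_(j < size la) c (nseqp la j) =
    \det (diag_mx (\row_(j < size la) c (nseqp la j))).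
  by rewrite det_diag; apply: eq_bigr => j _; rewrite mxE.
rewrite -det_nseqp -det_mulmx mul_mx_diag; congr (\det _).
by apply/matrixP => i j; rewrite !mxE.
Qed.

Lemma horner_ffact (R : comNzRingType) i n :
  (\prod_(k < i) ('X - (k%:R : R)%:P)).[n%:R] = (n ^_ i)%:R.
Proof.
elim: i => [|i IH]; first by rewrite big_ord0 hornerC ffactn0.
rewrite big_ord_recr /= hornerM IH hornerXsubC ffactnSr natrM.
case: (leqP i n) => h; first by rewrite natrB.
by rewrite ffact_small // !mul0r.
Qed.

(** The falling factorial of order [i] is a monic polynomial of degree [i], so the matrix is a
    unitriangular matrix times a Vandermonde matrix. *)
Lemma det_ffact (R : comNzRingType) r (n : nat -> nat) :
  \det (\matrix_(i < r, j < r) ((n j) ^_ i)%:R) =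
  \prod_(i < r) \prod_(j < r | (i < j)%N) ((n j)%:R - (n i)%:R) :> R.
Proof.
pose q i : {poly R} := \prod_(k < i) ('X - (k%:R : R)%:P).
have sq i : size (q i) = i.+1.
  by rewrite /q size_prod_XsubC /index_enum -enumT size_enum_ord.
have mq i : q i \is monic by apply: monic_prod_XsubC.
pose L : 'M[R]_r := \matrix_(i, l) (q i)`_l.
pose v : 'rV[R]_r := \row_j (n j)%:R.
have dL : \det L = 1.
  rewrite det_trig; last first.
    by apply/is_trig_mxP => i j ij; rewrite mxE nth_default // sq.
  apply: big1 => i _; rewrite mxE.
  by have := mq i; rewrite monicE lead_coefE sq => /eqP.
have -> : \matrix_(i < r, j < r) ((n j) ^_ i)%:R = L *m Vandermonde r v.
  apply/matrixP => i j; rewrite !mxE -horner_ffact -/(q i) (@horner_coef_wide _ r).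
    by apply: eq_bigr => l _; rewrite !mxE.
  by rewrite sq.
rewrite det_mulmx dL mul1r det_Vandermonde.
by apply: eq_bigr => i _; apply: eq_bigr => j _; rewrite !mxE.
Qed.

Section CharZero.
Variables (R : fieldType) (charR : [pchar R] =i pred0).
Let inv_fact m : R := (m`!)%:R^-1.

(* [sum_m t^m / m! = e^t] is the specialisation [p_1 = 1], [p_k = 0] for [k > 1]. *)
Lemma F_jacobi_trudi la : is_partition la ->
  (F la)%:R = ((sumn la)`!)%:R * jacobi_trudi inv_fact (size la) la.
Proof.
have [N] := ubnP (sumn la); elim: N la => // N IH la hN pla.
case: (posnP (sumn la)) => [n0|n0].
  have e : la = [::] by have := sumn_partition_gt0 pla; rewrite n0; case: (la).
  rewrite {}e /= {hN pla n0 la} in IH *.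
  rewrite fact0 mul1r /jacobi_trudi /beta_det det_mx00.
  suff -> : F [::] = 1%N by [].
  rewrite /F; apply/eqP/cards1P; exists [ffun=> ord0].
  apply/setP => t; rewrite !inE; apply/idP/eqP => _.
    by apply/ffunP => -[[]].
  by rewrite /is_syt; repeat (apply/andP; split); apply/forallP => -[[]].
have rec m : m%:R * inv_fact m = \sum_(1 <= k < m.+1) (k == 1%N)%:R * inv_fact (m - k)%N.
  case: m => [|m]; first by rewrite mul0r big_geq.
  rewrite big_ltn // big1_seq ?addr0 => [|k]; last first.
    by rewrite mem_index_iota => hk; rewrite gtn_eqF ?mul0r //; lia.
  rewrite mul1r subSS subn0 /inv_fact factS natrM invfM mulrA divff ?mul1r //.
  exact: natr_neq0.
have i0 : inv_fact 0 = 1 by rewrite /inv_fact fact0 invr1.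
have := jacobi_trudi_rec i0 rec pla.
rewrite big_ltn // [X in _ + X]big1_seq ?addr0 => [|k]; last first.
  by rewrite mem_index_iota => hk; rewrite gtn_eqF ?mul0r //; lia.
rewrite mul1r => e.
have nE : (sumn la)`!%:R = ((sumn la).-1)`!%:R * (sumn la)%:R :> R.
  by rewrite -{1}(prednK n0) factS natrM (prednK n0) mulrC.
rewrite nE -mulrA e F_rec // natr_sum mulr_sumr.
rewrite [RHS](eq_bigl (covers la)) => [|mu]; last exact: rim_hook1.
apply: eq_bigr => mu hc; have /andP[/andP[pmu _] /eqP sm] := hc.
rewrite ht_covers // mul1r IH // -?sm //.
by rewrite -ltnS sm.
Qed.

(** Scaling column [j] by [n_j!] turns [1 / (n_j - i)!] into a falling factorial, and [det_ffact]
    applies. *)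
Lemma Vdm_jacobi_trudi la : is_partition la ->
  jacobi_trudi inv_fact (size la) la * \prod_(j < size la) ((nseqp la j)`!)%:R = (Vdm la)%:R.
Proof.
move=> pla; rewrite -(det_scaled_nseqp inv_fact (fun n => (n`!)%:R)).
have -> : (Vdm la)%:R = \prod_(i < size la) \prod_(j < size la | (i < j)%N)
    ((nseqp la j)%:R - (nseqp la i)%:R) :> R.
  rewrite /Vdm natr_prod; apply: eq_bigr => i _; rewrite natr_prod.
  by apply: eq_bigr => j ij; rewrite natrB // ltnW // nseqp_lt.
rewrite -det_ffact; congr (\det _); apply/matrixP => i j; rewrite !mxE /hshift /inv_fact.
case: leqP => h; last by rewrite mul0r ffact_small.
by rewrite -(ffact_fact h) natrM mulrC mulfK ?fact_neq0.
Qed.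

Lemma Vdm_neq0 la : is_partition la -> (Vdm la)%:R != 0 :> R.
Proof.
move=> pla; apply: natr_neq0 => //; rewrite /Vdm.
apply: prodn_gt0 => i; apply: prodn_cond_gt0 => j ij.
by rewrite subn_gt0 nseqp_lt.
Qed.

Section Appell.
Variable A : nat -> {poly R}.
Hypothesis HA : appell A.

Lemma derivn_appell n i : (A n)^`(i) = hshift (scaled_appell A) n i * (n`!)%:R.
Proof.
elim: i => [|i IH].
  rewrite derivn0 /hshift leq0n subn0 /scaled_appell -polyC_natr mulrC mul_polyC.
  by rewrite scalerA divff ?fact_neq0 // scale1r.
rewrite derivnS IH -polyC_natr derivM derivC mulr0 addr0; congr (_ * _).
rewrite /hshift; case: (ltngtP i n) => h.
- by rewrite -[in LHS](@subnSK i n) // deriv_scaled_appell.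
- by rewrite deriv0.
- by rewrite h subnn scaled_appell0 // derivC.
Qed.

Lemma Wr_jacobi_trudi la :
  Wr A la = jacobi_trudi (scaled_appell A) (size la) la *
            \prod_(j < size la) ((nseqp la j)`!)%:R.
Proof.
rewrite -(det_scaled_nseqp _ (fun n => (n`!)%:R)); congr (\det _).
by apply/matrixP => i j; rewrite !mxE derivn_appell.
Qed.

(** The Wronskian and the Vandermonde product both contain the product of the [n_j!], and the latter
    and [F la] both contain the determinant at [1 / m!]; only [n!] times the determinant at [a_m]
    survives. *)
Lemma F_AL la : is_partition la ->
  (F la)%:R *: AL A la =
  ((sumn la)`!)%:R *: jacobi_trudi (scaled_appell A) (size la) la.
Proof.
move=> pla; rewrite /AL Wr_jacobi_trudi.
have -> : \prod_(j < size la) ((nseqp la j)`!)%:R =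
    (\prod_(j < size la) ((nseqp la j)`!)%:R)%:P :> {poly R}.
  by rewrite rmorph_prod; apply: eq_bigr => j _; rewrite /= polyC_natr.
rewrite [_ * _%:P]mulrC mul_polyC !scalerA; congr (_ *: _).
have := Vdm_jacobi_trudi pla; have := Vdm_neq0 pla => v0 e.
rewrite F_jacobi_trudi // -[RHS](mulfK v0) -{2}e.
by ring.
Qed.

End Appell.
End CharZero.

(** * The recurrence for Appell polynomials of partitions *)

Theorem theorem6p3 (R : fieldType) (charR : [pchar R] =i pred0)
  (A : nat -> {poly R}) (HA : appell A)
  (la : seq nat) (Hla : is_partition la) (Hn : (0 < sumn la)%N) :
  (F la)%:R *: AL A la =
    'X * (\sum_(mu <- subparts la | covers la mu) (F mu)%:R *: AL A mu)
  + \sum_(1 <= k < (sumn la).+1)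
      (cA A k * ('C((sumn la).-1, k.-1))%:R) *:
        \sum_(nu <- subparts la | rim_hook la nu k)
          ((-1) ^+ ht la nu * (F nu)%:R) *: AL A nu.
Proof.
set n := sumn la in Hn *.
pose JT nu : {poly R} := jacobi_trudi (scaled_appell A) (size nu) nu.
pose S k : {poly R} := \sum_(nu <- subparts la | rim_hook la nu k) (-1) ^+ ht la nu * JT nu.
have e : n%:R * JT la = \sum_(1 <= k < n.+1) appell_psum A k * S k.
  exact: (jacobi_trudi_rec (scaled_appell0 HA) (scaled_appell_rec charR HA) Hla).
(* The factorial is that of the size [n - k] of [nu], supplied by [F_AL]. *)
have hS k : (0 < k <= n)%N -> \sum_(nu <- subparts la | rim_hook la nu k)
    ((-1) ^+ ht la nu * (F nu)%:R) *: AL A nu = ((n - k)`!)%:R *: S k.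
  move=> hk; rewrite scaler_sumr; apply: eq_bigr => nu /and5P[pnu _ /eqP sz _ _].
  have -> : (n - k)%N = sumn nu by move: sz; rewrite -/n; lia.
  rewrite -scalerA F_AL // !scalerA mulrC -scalerA; congr (_ *: _).
  by rewrite -mul_polyC polyC_exp polyCN polyC1.
have nE : n`!%:R = (n.-1)`!%:R * n%:R :> R.
  by rewrite -{1}(prednK Hn) factS natrM (prednK Hn) mulrC.
have -> : \sum_(mu <- subparts la | covers la mu) (F mu)%:R *: AL A mu = (n.-1)`!%:R *: S 1%N.
  have := hS 1%N (ltac:(lia)); rewrite subn1 => <-.
  rewrite [RHS](eq_bigl (covers la)) => [|mu]; last exact: rim_hook1.
  by apply: eq_bigr => mu hc; rewrite ht_covers // mul1r.
have {}e : n%:R *: JT la = \sum_(1 <= k < n.+1) appell_psum A k * S k.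
  by rewrite -e -mul_polyC polyC_natr.
rewrite F_AL // nE -scalerA -/(JT la) e.
under eq_bigr do rewrite mulrDl.
rewrite big_split /= scalerDr; congr (_ + _).
  (* The variable enters [p_k] only for [k = 1], which yields the sum over covers. *)
  rewrite big_ltn // big1_seq ?addr0 => [|k]; last first.
    by rewrite mem_index_iota => hk; rewrite gtn_eqF ?mul0r //; lia.
  by rewrite eqxx scalerAr.
rewrite scaler_sumr; apply: eq_big_nat => k /andP[k0 kn].
rewrite hS ?k0 // mul_polyC !scalerA; congr (_ *: _).
have h : (k.-1 <= n.-1)%N by lia.
(* Here [(n-1)! / (k-1)!] becomes the binomial coefficient times [(n-k)!]. *)
rewrite -(bin_fact h) /log_sum !natrM.
have -> : (n.-1 - k.-1 = n - k)%N by lia.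
by field; rewrite fact_neq0.
Qed.
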